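(* For every MCFTG $G$ with terminal alphabet $\Sigma$ there is an MCFG $G'$ with terminal alphabet $\Sigma\cup\{\triangleright\}$ (in $G'$ all symbols of $\Sigma$ have rank 1 and $\triangleright\notin\Sigma$ has rank 0) that is $\mathrm{LDT}^{\mathrm R}$-equivalent to $G$ when every tree $t\in T_\Sigma$ (a string over $\Sigma$) is identified with the tree $t\triangleright$ over $\Sigma\cup\{\triangleright\}$; that is, $G'$ is $\mathrm{LDT}^{\mathrm R}$-$\varphi$-equivalent to $G$ for $\varphi(t)=t\triangleright$. For $\Delta\subseteq\Sigma$, if $G$ is $\Delta$-lexicalized, then so is $G'$. Moreover, $\mu(G')=\mu(G)\cdot(\theta(G)+1)$ and $\lambda(G')=\lambda(G)$. If $G$ is footed, then ($G'$ can be taken with) $\mu(G')=2\cdot\mu(G)$.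
   Context: **Sequences and trees.** $\mathbb N_0$ is the set of nonnegative integers, $[n]=\{1,\dots,n\}$. $A^*$ (resp. $A^+$) is the set of finite (resp. nonempty finite) sequences over $A$; a sequence of length 1 is identified with its element; juxtaposition is concatenation; $\mathrm{occ}(w)$ is the set of elements occurring in the sequence $w$; $w$ is repetition-free if no element occurs twice in it. A ranked alphabet is a set $\Sigma$ with a rank map $\mathrm{rk}\colon\Sigma\to\mathbb N_0$ (applied elementwise to sequences); $\Sigma^{(k)}$ is the set of symbols of rank $k$; for finite $\Sigma$, $\mathrm{mr}_\Sigma$ is the maximal rank of its symbols. $T_\Sigma$ is the set of trees over $\Sigma$: the smallest set of strings over $\Sigma$ containing $\sigma t_1\cdots t_k$ (also written $\sigma(t_1,\dots,t_k)$) for all $\sigma\in\Sigma^{(k)}$ and $t_i\in T_\Sigma$. A forest is a finite sequence of trees. $X=\{x_1,x_2,\dots\}$ is a set of variables (of rank 0, disjoint from other alphabets), $X_k=\{x_1,\dots,x_k\}$. A pattern of rank $k$ over $\Sigma$ is a tree over $\Sigma\cup X_k$ in which each of $x_1,\dots,x_k$ occurs exactly once; $P_\Sigma(X_k)$ is the set of these and $P_\Sigma(X)=\bigcup_k P_\Sigma(X_k)$. For a forest $t$, $\mathrm{occ}_\Omega(t)$ is the set of symbols of $\Omega$ occurring in $t$; $t$ is uniquely $\Omega$-labeled if each symbol of $\Omega$ occurs at most once in $t$. **Substitution.** For a repetition-free sequence of symbols $\sigma=(\sigma_1,\dots,\sigma_n)$ and patterns $u=(u_1,\dots,u_n)$ with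 $\mathrm{rk}(u)=\mathrm{rk}(\sigma)$, $t[\sigma\gets u]$ is obtained from $t$ by replacing, recursively, each subtree $\sigma_i(s_1,\dots,s_k)$ by $u_i$ in which $x_j$ is replaced by the transformed $s_j$ (componentwise on forests). For $\mathcal L=\{B_1,\dots,B_k\}$ with $B_1\cdots B_k$ repetition-free and forests $f(B_i)$ with $\mathrm{rk}(f(B_i))=\mathrm{rk}(B_i)$, $t[B\gets f(B)\mid B\in\mathcal L]$ means $t[B_1\cdots B_k\gets f(B_1)\cdots f(B_k)]$. **MCFTG.** A multiple context-free tree grammar (MCFTG) is $G=(N,\mathcal N,\Sigma,S,R)$ where $N$ is a finite ranked alphabet of nonterminals; $\mathcal N\subseteq N^+$ is a finite set of repetition-free sequences (big nonterminals) with $\mathrm{occ}(A)\ne\mathrm{occ}(A')$ for distinct $A,A'\in\mathcal N$; $\Sigma$ is a finite ranked alphabet of terminals, disjoint from $N$, with $\mathrm{mr}_\Sigma\ge1$; $S\in\mathcal N\cap N^{(0)}$ is the initial nonterminal; $R$ is a finite set of rules $A\to(u,\mathcal L)$ with $A\in\mathcal N$, $u\in P_{N\cup\Sigma}(X)^+$ a uniquely $N$-labeled forest with $\mathrm{rk}(u)=\mathrm{rk}(A)$, and $\mathcal L\subseteq\mathcal N$ (the links) such that the sets $\mathrm{occ}(B)$, $B\in\mathcal L$, are pairwise disjoint with union $\mathrm{occ}_N(u)$. The sets $L(G,A)$, $A\in\mathcal N$, are simultaneously the smallest sets of forests such that for every rule $A\to(u,\mathcal L)$ and all $f(B)\in L(G,B)$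 ($B\in\mathcal L$), $u[B\gets f(B)\mid B\in\mathcal L]\in L(G,A)$. $L(G)=L(G,S)\subseteq T_\Sigma$. The multiplicity is $\mu(G)=\max\{|A|: A\in\mathcal N\}$; the width is $\theta(G)=\max\{\mathrm{rk}(C): C\in N\}$; the rule-width $\lambda(G)$ is the maximal number $|\mathcal L|$ of links of a rule. Grammars are not required to be free of useless or unreachable (big) nonterminals. Convention: every MCFTG is start-separated, i.e. $S$ does not occur in right-hand sides of rules. **MCFG.** A multiple context-free grammar (MCFG) is a (start-separated) MCFTG $(N\cup\{S\},\mathcal N,\Sigma\cup\{\triangleright\},S,R)$ with $S\notin N$ of rank 0, every nonterminal in $N$ of rank 1, $\triangleright\notin\Sigma$ of rank 0, and every terminal in $\Sigma$ of rank 1. **Derivation trees.** For every rule fix a linear order on its links; a rule with $k$ links has rank $k$, so $R$ is a ranked alphabet. The sets $L(G_{\mathrm{der}},A)\subseteq T_R$ are the smallest sets such that $\rho(d_1,\dots,d_k)\in L(G_{\mathrm{der}},A)$ whenever $\rho=A\to(u,\{B_1,\dots,B_k\})\in R$ (links in their order) and $d_i\in L(G_{\mathrm{der}},B_i)$; and $\mathrm{val}(\rho(d_1,\dots,d_k))=u[B_i\gets\mathrm{val}(d_i)\mid 1\le i\le k]$. $L(G_{\mathrm{der}})=L(G_{\mathrm{der}},S)$. **$\mathrm{LDT}^{\mathrm R}$-$\varphi$-equivalence.** A linear deterministic top-down tree transducer with regular look-ahead ($\mathrm{LDT}^{\mathrm R}$-transducer) from $\Omega$ to $\Sigma$ has a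 finite state set $Q$, an initial state $q_0$, and finitely many rules $\langle q,\omega(y_1{:}L_1,\dots,y_k{:}L_k){:}L_0\rangle\to\zeta$ with $q\in Q$, $\omega\in\Omega^{(k)}$, $L_0,\dots,L_k$ regular tree languages over $\Omega$, and $\zeta$ a tree over $\Sigma$ and rank-0 symbols $\langle q',y_i\rangle$ ($q'\in Q$, $i\in[k]$) in which each $y_i$ occurs at most once; for two distinct rules with the same $q,\omega$ and look-ahead languages $L_i$, $L_i'$ there is $0\le i\le k$ with $L_i\cap L_i'=\emptyset$. For $s=\omega(s_1,\dots,s_k)$, $M_q(s)=\zeta[\langle q',y_i\rangle\gets M_{q'}(s_i)]$ if there is a rule $\langle q,\omega(y_1{:}L_1,\dots,y_k{:}L_k){:}L_0\rangle\to\zeta$ with $s\in L_0$, $s_i\in L_i$ for all $i\in[k]$ (undefined if there is no such rule or some needed $M_{q'}(s_i)$ is undefined); it realizes the partial function $M=M_{q_0}\colon T_\Omega\to T_\Sigma$. Let $G,G'$ be MCFTGs with terminal alphabets $\Sigma,\Sigma'$ and rule sets $R,R'$, and $\varphi\colon T_\Sigma\to T_{\Sigma'}$. $G'$ is $\mathrm{LDT}^{\mathrm R}$-$\varphi$-equivalent to $G$ if there are such transductions $M\colon T_R\to T_{R'}$, $M'\colon T_{R'}\to T_R$ with $M(d)\in L(G'_{\mathrm{der}})$ and $\mathrm{val}(M(d))=\varphi(\mathrm{val}(d))$ for all $d\in L(G_{\mathrm{der}})$, and $M'(d')\in L(G_{\mathrm{der}})$ and $\varphi(\mathrm{val}(M'(d')))=\mathrm{val}(d')$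 for all $d'\in L(G'_{\mathrm{der}})$ (so $L(G')=\varphi(L(G))$). **Lexicalization.** A rule $A\to(u,\mathcal L)$ is initial if $A=S$, terminal if $\mathcal L=\emptyset$, proper if it is not both initial and terminal, and $\Delta$-lexicalized if some symbol of $\Delta$ occurs in $u$. $G$ is $\Delta$-lexicalized if all its proper rules are. **Footed.** A pattern $t\in P_{N\cup\Sigma}(X_k)$ is footed if either $k=0$, or $k\ge1$ and $t$ has a node labeled by a symbol of $N\cup\Sigma$ of rank $k$ whose $i$-th child is labeled $x_i$ for every $i\in[k]$. An MCFTG is footed if for each rule $A\to((u_1,\dots,u_n),\mathcal L)$ all $u_j$ are footed. *)

(* Defs.v *)
From mathcomp Require Import all_boot.

Set Implicit Arguments.
Unset Strict Implicit.
Unset Printing Implicit Defensive.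

Record ralphabet := RAlphabet { symbol :> finType; rk : symbol -> nat }.

Definition sum_rk (N A : ralphabet) (x : N + A) : nat :=
  match x with inl C => rk C | inr a => rk a end.

(* Unranked trees over [A] with leaves [Var v], [v : V]; the rank condition is
   the separate predicate [well_ranked].  Trees of T_A have V := void, patterns
   have V := nat with [Var j] standing for x_(j+1). *)
Inductive tree (V A : Type) : Type :=
| Var of V
| Node of A & seq (tree V A).
Arguments Var {V A}.
Arguments Node {V A}.

Section Trees.
Variables (V A : Type).

Fixpoint well_ranked (r : A -> nat) (t : tree V A) : bool :=
  match t with
  | Var _ => true
  | Node a ts => (size ts == r a) && all (well_ranked r) ts
  end.

(* Variables and symbols of a tree in pre-order, with repetitions.  For
   V := void, [labels t] is the tree t in prefix notation, as a string. *)
Fixpoint vars (t : tree V A) : seq V :=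
  match t with
  | Var v => [:: v]
  | Node _ ts => flatten (map vars ts)
  end.

Fixpoint labels (t : tree V A) : seq A :=
  match t with
  | Var _ => [::]
  | Node a ts => a :: flatten (map labels ts)
  end.

Definition forest_labels (u : seq (tree V A)) : seq A :=
  flatten (map labels u).

End Trees.

Fixpoint bind (V W A : Type) (f : V -> tree W A) (t : tree V A) : tree W A :=
  match t with
  | Var v => f v
  | Node a ts => Node a (map (bind f) ts)
  end.

Definition of_closed (V A : Type) : tree void A -> tree V A :=
  bind (of_void (tree V A)).

Definition is_pattern (A : Type) (r : A -> nat) (k : nat) (t : tree nat A) : bool :=
  well_ranked r t && perm_eq (vars t) (iota 0 k).

Definition var_index (A : Type) (t : tree nat A) : option nat :=
  if t is Var j then Some j else None.

Fixpoint has_foot (A : Type) (r : A -> nat) (k : nat) (t : tree nat A) : bool :=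
  match t with
  | Var _ => false
  | Node a ts =>
      ((r a == k) && (map (@var_index A) ts == map Some (iota 0 k)))
      || has (has_foot r k) ts
  end.

Definition footed_pattern (A : Type) (r : A -> nat) (k : nat) (t : tree nat A) : bool :=
  (k == 0) || has_foot r k t.

(* t[sg <- u].  It is only applied when every nonterminal of t occurs in sg and
   sg, u have the same ranks, so that the defaults of [nth] are never used and
   no nonterminal is left in the result. *)
Fixpoint subst (N : eqType) (A : Type) (sg : seq N) (u : seq (tree nat A))
    (t : tree nat (N + A)) : tree nat A :=
  match t with
  | Var j => Var j
  | Node (inl C) ts =>
      bind (fun j => nth (Var j) (map (subst sg u) ts) j)
           (nth (Var 0) u (index C sg))
  | Node (inr a) ts => Node a (map (subst sg u) ts)
  end.

Definition nonterminals (N A : Type) (u : seq (tree nat (N + A))) : seq N :=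
  pmap (fun x => if x is inl C then Some C else None) (forest_labels u).

(* Start-separated multiple context-free tree grammars over the terminal
   alphabet [A].  Nonterminals and terminals are kept disjoint by [sum].  The
   rules form a finite type, identified with a set of triples (B, u, L) by
   [rule_inj]; [links] lists the set L in the linear order chosen for it. *)
Record mcftg (A : ralphabet) := MCFTG {
  nt : ralphabet;
  bignt : seq (seq nt);
  start : nt;
  rule : finType;
  lhs : rule -> seq nt;
  rhs : rule -> seq (tree nat (nt + A));
  links : rule -> seq (seq nt);
  terminal_mr : [exists a : A, 0 < rk a];
  bignt_neq0 : forall B : seq nt, B \in bignt -> B != [::];
  bignt_uniq : forall B : seq nt, B \in bignt -> uniq B;
  bignt_occ : forall B B' : seq nt,
    B \in bignt -> B' \in bignt -> B =i B' -> B = B';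
  start_bignt : [:: start] \in bignt;
  start_rk : rk start = 0;
  rule_inj : forall r r',
    lhs r = lhs r' -> rhs r = rhs r' -> links r =i links r' -> r = r';
  lhs_bignt : forall r, lhs r \in bignt;
  rhs_pattern : forall r,
    all2 (fun C t => is_pattern (@sum_rk nt A) (rk C) t) (lhs r) (rhs r);
  rhs_uniq : forall r, uniq (nonterminals (rhs r));
  links_uniq : forall r, uniq (links r);
  links_bignt : forall r, {subset links r <= bignt};
  links_disjoint : forall r (B B' : seq nt),
    B \in links r -> B' \in links r -> B != B' -> [disjoint B & B'];
  links_cover : forall r, flatten (links r) =i nonterminals (rhs r);
  start_separated : forall r, start \notin nonterminals (rhs r)
}.
Arguments start {A} m.
Arguments bignt {A} m.

Section Grammar.
Variables (A : ralphabet) (G : mcftg A).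

Definition multiplicity : nat := \max_(B <- bignt G) size B.
Definition width : nat := \max_(C : nt G) rk C.
Definition rule_width : nat := \max_(r : rule G) size (links r).

Definition rules : ralphabet := RAlphabet (fun r : rule G => size (links r)).

Fixpoint derivation (d : tree void rules) (B : seq (nt G)) : bool :=
  match d with
  | Var _ => false
  | Node r ds => (lhs r == B) && all2 derivation ds (links r)
  end.

Definition Lder (d : tree void rules) : bool := derivation d [:: start G].

Fixpoint dval (d : tree void rules) : seq (tree nat A) :=
  match d with
  | Var _ => [::]
  | Node r ds =>
      map (subst (flatten (links r)) (flatten (map dval ds))) (rhs r)
  end.

Definition initial (r : rule G) : bool := lhs r == [:: start G].
Definition terminal (r : rule G) : bool := links r == [::].
Definition proper (r : rule G) : bool := ~~ (initial r && terminal r).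

Definition lexicalized_rule (D : {set A}) (r : rule G) : bool :=
  [exists a in D, inr a \in forest_labels (rhs r)].

Definition lexicalized (D : {set A}) : Prop :=
  forall r, proper r -> lexicalized_rule D r.

Definition footed : Prop := forall r : rule G,
  all2 (fun C t => footed_pattern (@sum_rk (nt G) A) (rk C) t) (lhs r) (rhs r).

End Grammar.

Record dfta (A : ralphabet) := DFTA {
  dfta_state : finType;
  dfta_step : A -> seq dfta_state -> dfta_state;
  dfta_final : {set dfta_state}
}.

Fixpoint dfta_run (A : ralphabet) (M : dfta A) (t : tree void A) : dfta_state M :=
  match t with
  | Var v => of_void (dfta_state M) v
  | Node a ts => dfta_step a (map (dfta_run M) ts)
  end.

Definition regular (A : ralphabet) (L : pred (tree void A)) : Prop :=
  exists M : dfta A, forall t,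
    L t = well_ranked (@rk A) t && (dfta_run M t \in dfta_final M).

(* LDT^R-transducers.  A rule
     <q, w(y_1 : L_1, ..., y_k : L_k) : L_0> -> z
   has [look_arg] i = L_(i+1) (for i < k) and [look_root] = L_0; the symbol
   <q', y_(i+1)> of z is the leaf [Var (q', i)]. *)
Record ldtr (A A' : ralphabet) := LDTR {
  state : finType;
  state0 : state;
  trule : finType;
  t_state : trule -> state;
  t_symbol : trule -> A;
  look_root : trule -> pred (tree void A);
  look_arg : trule -> nat -> pred (tree void A);
  t_out : trule -> tree (state * nat) A';
  look_root_regular : forall p, regular (look_root p);
  look_arg_regular : forall p i, i < rk (t_symbol p) -> regular (look_arg p i);
  t_out_ranked : forall p, well_ranked (@rk A') (t_out p);
  t_out_vars : forall p, all (fun x => x.2 < rk (t_symbol p)) (vars (t_out p));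
  t_out_linear : forall p, uniq (map snd (vars (t_out p)));
  t_deterministic : forall p p', p != p' ->
    t_state p = t_state p' -> t_symbol p = t_symbol p' ->
    (forall s, ~~ (look_root p s && look_root p' s)) \/
    (exists2 i, i < rk (t_symbol p) &
       forall s, ~~ (look_arg p i s && look_arg p' i s))
}.
Arguments state0 {A A'} l.

(* [transduces M q s t] means that M_q(s) is defined and equal to t. *)
Inductive transduces (A A' : ralphabet) (M : ldtr A A') :
    state M -> tree void A -> tree void A' -> Prop :=
| Transduces (p : trule M) (ss : seq (tree void A))
    (f : state M * nat -> tree void A') :
    look_root p (Node (t_symbol p) ss) ->
    (forall i s, onth ss i = Some s -> look_arg p i s) ->
    (forall q i s, (q, i) \in vars (t_out p) -> onth ss i = Some s ->
       transduces q s (f (q, i))) ->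
    transduces (t_state p) (Node (t_symbol p) ss) (bind f (t_out p)).

(* val(d') = phi(val(d)); both values are forests of length one without
   variables. *)
Definition val_related (A A' : ralphabet) (phi : tree void A -> tree void A')
    (G : mcftg A) (G' : mcftg A')
    (d : tree void (rules G)) (d' : tree void (rules G')) : Prop :=
  exists2 t, dval d = [:: of_closed nat t] & dval d' = [:: of_closed nat (phi t)].

Definition ldtr_equivalent (A A' : ralphabet) (phi : tree void A -> tree void A')
    (G' : mcftg A') (G : mcftg A) : Prop :=
  (exists M : ldtr (rules G) (rules G'), forall d, Lder d ->
     exists d', [/\ transduces (state0 M) d d', Lder d' & val_related phi d d'])
  /\
  (exists M' : ldtr (rules G') (rules G), forall d', Lder d' ->
     exists d, [/\ transduces (state0 M') d' d, Lder d & val_related phi d d']).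

(* The alphabet A + {end marker}: [Some a] is a with rank 1, [None] is the end
   marker of rank 0. *)
Definition string_alphabet (A : ralphabet) : ralphabet :=
  RAlphabet (fun x : option A => nat_of_bool (isSome x)).

Definition is_mcfg (A : ralphabet) (G : mcftg (string_alphabet A)) : Prop :=
  forall C : nt G, C != start G -> rk C = 1.

Definition string_tree (A : ralphabet) (t : tree void A) :
    tree void (string_alphabet A) :=
  foldr (fun a s => Node (Some a) [:: s]) (Node None [::]) (labels t).

(* Main.v *)
(* A tree t is the string labels t, so a pattern of rank k over terminals is a
   word w_0 x_(s_1) w_1 ... x_(s_k) w_k for a permutation s of its variables.  A
   nonterminal C of rank k is therefore simulated by k+1 nonterminals of rank 1
   deriving w_0, ..., w_k; the order s is guessed in their names, and a rule is
   encoded by replacing C(t_1, ..., t_k) by C_0 t_(s_1) C_1 ... t_(s_k) C_k and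
   cutting the resulting word at its variables.  If the grammar is footed, the
   variables of every derived pattern are contiguous, so that only w_0 and w_k
   can be nonempty and two pieces suffice.  The orders are determined by the
   derivation tree from the leaves upwards, hence by a regular look-ahead, and
   the encoding of trees as words is a prefix code, so that distinct rules stay
   distinct. *)
Require Import Defs.
From mathcomp Require Import all_boot.

Set Implicit Arguments.
Unset Strict Implicit.
Unset Printing Implicit Defensive.

(** * Trees and words with variables *)

(** One construction serves both halves: the parameter [keep] selects the pieces that get
    nonterminals, and all that matters about the others is that they are empty. Piece 0 is never
    dropped. Its symbol opens the code of every nonterminal node, which makes the code a prefix
    code, and it carries the annotation, so that orders can be read off the names. A rule guesses
    orders only for the nonterminals on its right-hand side; those on the left are computed from the
    encoded components. Hence a derivation tree of [G] admits exactly one consistent annotation, the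
    derivation trees of the two grammars are in bijection, and both transducers merely relabel
    nodes. The multiplicity has to be attained exactly, but a largest big nonterminal need not
    consist of nonterminals of maximal rank. A big nonterminal of the required size that occurs in
    no rule is therefore added. *)

Section TreeInduction.
Variables (V B : Type) (P : tree V B -> Prop).

(** The children of a node sit in a list, so the induction principle generated for [tree] has no
    hypothesis about them; this predicate supplies it. *)
Fixpoint Each (ts : seq (tree V B)) : Prop :=
  if ts is t :: ts' then P t /\ Each ts' else True.

Lemma Each_nth ts x0 i : Each ts -> i < size ts -> P (nth x0 ts i).
Proof. by elim: ts i => [|t ts IH] [|i] //= [Pt Pts]; [|apply: IH]. Qed.

Hypothesis PVar : forall v, P (Var v).
Hypothesis PNode : forall a ts, Each ts -> P (Node a ts).

Fixpoint tree_each_ind (t : tree V B) : P t :=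
  match t with
  | Var v => PVar v
  | Node a ts => PNode a
      ((fix each ts : Each ts :=
          match ts with
          | [::] => I
          | t :: ts' => conj (tree_each_ind t) (each ts')
          end) ts)
  end.

End TreeInduction.

Section Words.
Variables X : Type.
Implicit Type e : seq (nat + X).

Definition evars e : seq nat :=
  pmap (fun x => if x is inl j then Some j else None) e.
Definition syms e : seq X :=
  pmap (fun x => if x is inr y then Some y else None) e.

(* [piece i e] is the factor w_i of the word e = w_0 x_(s_1) w_1 ... x_(s_k) w_k;
   it is empty for i > k. *)
Fixpoint piece i e : seq X :=
  match e, i with
  | [::], _ => [::]
  | inl _ :: e', 0 => [::]
  | inl _ :: e', i'.+1 => piece i' e'
  | inr x :: e', 0 => x :: piece 0 e'
  | inr _ :: e', _.+1 => piece i e'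
  end.

(* The word p_i f_(s_1) p_(i+1) f_(s_2) ... f_(s_k) p_(i+k). *)
Fixpoint weave (p f : nat -> seq X) (s : seq nat) i : seq X :=
  p i ++ if s is j :: s' then f j ++ weave p f s' i.+1 else [::].

Lemma eq_weave p p' f f' s i :
  (forall l, i <= l <= i + size s -> p l = p' l) -> {in s, f =1 f'} ->
  weave p f s i = weave p' f' s i.
Proof.
elim: s i => [|j s IH] i /= pp ff; rewrite pp ?addn0 ?leqnn ?leq_addr //.
rewrite ff ?mem_head // IH // => [l /andP[il ls]|l ls].
  by apply: pp; rewrite ltnW // addnS.
by apply: ff; rewrite inE ls orbT.
Qed.

Lemma weave_succ p f s i :
  weave p f s i.+1 = weave (fun l => p l.+1) f s i.
Proof. by elim: s i => [|j s IH] i //=; rewrite IH. Qed.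

Lemma weave_mem p f s i j : j \in s ->
  exists y z, weave p f s i = y ++ f j ++ z.
Proof.
elim: s i => //= j' s IH i; rewrite inE => /orP[/eqP->|/(IH i.+1)[y [z ->]]].
  by exists (p i), (weave p f s i.+1).
by exists (p i ++ f j' ++ y), z; rewrite -!catA.
Qed.

(** Unique decoding: the separators on both sides agree and cancel, and each [f j] is peeled off as
    a prefix. [R j] records what equality of the two codewords at [j] yields. *)
Lemma weave_inj (R : nat -> Prop) p f f' s i z z' :
  (forall j y y', j \in s -> f j ++ y = f' j ++ y' -> R j /\ y = y') ->
  weave p f s i ++ z = weave p f' s i ++ z' ->
  (forall j, j \in s -> R j) /\ z = z'.
Proof.
have cat_inj (y u v : seq X) : y ++ u = y ++ v -> u = v.
  by elim: y => //= x y IH [].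
elim: s i => [|j s IH] i /= Rf; rewrite -!catA => /cat_inj //.
move=> E.
have [Rj E'] := Rf j _ _ (mem_head _ _) E.
have [|Rs ->] := IH i.+1 _ E'.
  by move=> l y y' ls; apply: Rf; rewrite inE ls orbT.
by split=> // l; rewrite inE => /orP[/eqP->|/Rs].
Qed.

(** With a single separator in front and the identity order, weaving is prefix notation: the case of
    a terminal node. *)
Lemma weave_flatten (p0 : seq X) (f : nat -> seq X) k :
  weave (fun i => if i is 0 then p0 else [::]) f (iota 0 k) 0 =
  p0 ++ flatten (map f (iota 0 k)).
Proof.
suff E s i : weave (fun i => if i is 0 then p0 else [::]) f s i.+1 =
    flatten (map f s).
  by case: k => [|k] //=; rewrite E.
by elim: s i => [|j s IH] i //=; rewrite IH.
Qed.

End Words.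

(** This is why a pattern can be simulated by its pieces and the order of its variables alone:
    substitution inserts the arguments, in that order, between the images of the pieces. *)
Lemma flatten_map_weave (X Y : Type) (f : nat -> seq Y) (g : X -> seq Y)
    (e : seq (nat + X)) :
  flatten [seq match x with inl j => f j | inr y => g y end | x <- e] =
  weave (fun i => flatten (map g (piece i e))) f (evars e) 0.
Proof.
elim: e => [|[j|x] e /= ->] //=.
  by rewrite weave_succ.
by case: (evars e) => [|j s] /=; rewrite ?catA // !weave_succ.
Qed.


(** A weave uses every separator and every inserted word once, so its letters can be counted
    regardless of order. The map [g] will extract the variables or the symbols. *)
Lemma perm_pmap_weave (X : Type) (Y : eqType) (g : X -> option Y) p f s i :
  perm_eq (pmap g (weave p f s i))
    (flatten [seq pmap g (p l) | l <- iota i (size s).+1]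
     ++ flatten [seq pmap g (f j) | j <- s]).
Proof.
elim: s i => [|j s IH] i; first by rewrite /= pmap_cat !cats0.
rewrite [weave _ _ _ _]/= [iota _ _]/= !pmap_cat /= -!catA perm_cat2l.
rewrite catA perm_sym perm_catCA perm_cat2l perm_sym.
exact: IH.
Qed.

Section MoreWords.
Variables X Y : Type.
Implicit Type e : seq (nat + X).

Lemma all_piece (p : pred X) e i : all p (syms e) -> all p (piece i e).
Proof.
elim: e i => [|[j|x] e IH] [|i] //=; [exact: IH|by case/andP=> ->; exact: IH|].
by case/andP=> _; exact: IH.
Qed.

Lemma flatten_pieces e :
  flatten [seq piece i e | i <- iota 0 (size (evars e)).+1] = syms e.
Proof.
have iotaS m n : iota m.+1 n = map S (iota m n) by exact: (iotaDl 1).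
elim: e => [|[j|x] e IH] //=; rewrite -/(syms _) -IH /= !iotaS -!map_comp //.
Qed.

Lemma eq_words e e' : evars e = evars e' ->
  (forall i, i <= size (evars e) -> piece i e = piece i e') -> e = e'.
Proof.
move=> Ev Ep.
(* Substituting every variable and symbol for itself exhibits a word as the weave of its own pieces
   around its variables. *)
have E (w : seq (nat + X)) : w = weave (fun i => map inr (piece i w))
    (fun j => [:: inl j]) (evars w) 0.
  have /= := flatten_map_weave (fun j => [:: inl j]) (fun x => [:: inr x]) w.
  have -> : flatten [seq match x with
      inl j => [:: inl j] | inr y => [:: inr y] end | x <- w] = w.
    by elim: w => [|[] x w /= ->].
  move=> {1}->; apply: eq_weave => // l _.
  by rewrite flatten_map1.
by rewrite (E e) (E e') -Ev; apply: eq_weave => // l /= ls; rewrite Ep.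
Qed.

Definition hom (h : X -> seq Y) e : seq (nat + Y) :=
  flatten [seq match x with inl j => [:: inl j] | inr y => map inr (h y) end
          | x <- e].

Lemma piece_cat_inr (w : seq Y) (e : seq (nat + Y)) i :
  piece i (map inr w ++ e) = (if i is 0 then w else [::]) ++ piece i e.
Proof. by elim: w => [|y w IH] /=; [case: i|case: i IH => [|i] /= ->]. Qed.

Lemma evars_hom h e : evars (hom h e) = evars e.
Proof.
elim: e => [|[j|x] e IH] //=; first by rewrite -IH.
rewrite /hom /= /evars pmap_cat -/(hom h e) -/(evars (hom h e)) IH.
by elim: (h x).
Qed.

Lemma piece_hom h e i : piece i (hom h e) = flatten (map h (piece i e)).
Proof.
elim: e i => [|[j|x] e IH] i //=; first by case: i => [|i] //=; exact: IH.
rewrite /hom /= piece_cat_inr -/(hom h e).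
by case: i => [|i] /=; rewrite IH.
Qed.

Lemma hom_cat h e e' : hom h (e ++ e') = hom h e ++ hom h e'.
Proof. by rewrite /hom map_cat flatten_cat. Qed.

Lemma hom_weave h (p f : nat -> seq (nat + X)) s i :
  hom h (weave p f s i) = weave (hom h \o p) (hom h \o f) s i.
Proof.
by elim: s i => [|j s IH] i /=; rewrite !hom_cat //= IH.
Qed.

Lemma evars_nil e : evars e = [::] -> e = map inr (piece 0 e).
Proof. by elim: e => [|[] x e IH] //= /IH {1}->. Qed.

Lemma piece_inner (y z : seq X) s i : 0 < i < size s ->
  piece i (map inr y ++ map inl s ++ map inr z) = [::].
Proof.
elim: y => [|x y IH] /=; last by case: i IH.
case: s i => [|j s] // [|i] //=.
elim: s i => [|j' s IH] [|i] //= si; exact: IH.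
Qed.

Lemma evars_cat e e' : evars (e ++ e') = evars e ++ evars e'.
Proof. exact: pmap_cat. Qed.

Lemma evars_inl s : evars (map inl s : seq (nat + X)) = s.
Proof. by elim: s => //= j s ->. Qed.

End MoreWords.

(** * Words as monadic trees *)

Section Lines.
Variables X : Type.

Definition line (V : Type) (z : tree V X) (w : seq X) : tree V X :=
  foldr (fun x t => Node x [:: t]) z w.

Lemma labels_line V (z : tree V X) w : labels (line z w) = w ++ labels z.
Proof. by elim: w => //= x w ->; rewrite cats0. Qed.

Lemma vars_line V (z : tree V X) w : vars (line z w) = vars z.
Proof. by elim: w => //= x w ->; rewrite cats0. Qed.

Lemma line_inj V (z : tree V X) : injective (line z).
Proof.
move=> w w' /(congr1 (@labels _ _)); rewrite !labels_line => E.
have sz : size w = size w'.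
  by have /eqP := congr1 size E; rewrite !size_cat eqn_add2r => /eqP.
by have := congr1 (take (size w)) E; rewrite take_size_cat // sz take_size_cat.
Qed.

Lemma bind_line V W (f : V -> tree W X) z w :
  bind f (line z w) = line (bind f z) w.
Proof. by elim: w => //= x w ->. Qed.

End Lines.

(** Substituting a line at a node of rank 1 prepends its word, so on lines substitution is a word
    homomorphism [h] that fixes the terminals. *)
Lemma subst_line (N : eqType) (X : Type) (sg : seq N) (u : seq (tree nat X))
    (h : N + X -> seq X) z w :
  (forall x, h (inr x) = [:: x]) ->
  (forall C,
     C \in pmap (fun x : N + X => if x is inl C then Some C else None) w ->
     nth (Var 0) u (index C sg) = line (Var 0) (h (inl C))) ->
  subst sg u (line z w) = line (subst sg u z) (flatten (map h w)).
Proof.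
move=> hr hl; elim: w hl => [|[C|x] w IH] //= hl; last by rewrite IH // hr.
rewrite hl ?mem_head // IH => [|D Dw]; last by apply: hl; rewrite inE Dw orbT.
by rewrite bind_line /line foldr_cat.
Qed.

(** Both sides consist of blocks of the same lengths [size (t x)], so the concatenations can be cut
    block by block. *)
Lemma allpairs_eq_in (S T : eqType) R (f g : S -> T -> R) s t :
  [seq f x y | x <- s, y <- t x] = [seq g x y | x <- s, y <- t x] ->
  {in s, forall x, {in t x, f x =1 g x}}.
Proof.
elim: s => //= x s IH E x'; rewrite inE => /orP[/eqP->|xs].
  apply/eq_in_map; have := congr1 (take (size (t x))) E.
  by rewrite !take_size_cat ?size_map.
apply: (IH _ x' xs); have := congr1 (drop (size (t x))) E.
by rewrite !drop_size_cat ?size_map.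
Qed.

Lemma all2_nthP (S T : Type) (p : S -> T -> bool) s t x0 y0 :
  reflect (size s = size t /\
           forall i, i < size t -> p (nth x0 s i) (nth y0 t i)) (all2 p s t).
Proof.
rewrite all2E; apply: (iffP andP) => -[sz].
  move/eqP: sz => sz /(all_nthP (x0, y0)) pn; split=> // i it.
  by have := pn i; rewrite size_zip sz minnn nth_zip //; apply.
move=> pn; split; first exact/eqP.
apply/(all_nthP (x0, y0)) => i; rewrite size_zip sz minnn nth_zip //; exact: pn.
Qed.

Lemma mem_piece (X : eqType) (e : seq (nat + X)) i y :
  y \in piece i e -> y \in syms e.
Proof.
by move: y; apply/allP/(@all_piece _ (fun y => y \in syms e)); apply/allP.
Qed.

(** * Relabeling transducers with look-ahead *)

Lemma well_ranked_regular (B : ralphabet) :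
  regular (fun t : tree void B => well_ranked (@rk B) t).
Proof.
exists (DFTA (fun=> fun=> tt) [set: unit]) => t.
by rewrite inE andbT.
Qed.

(* A transducer with one state, whose look-ahead selects for each node one of
   the relabelings [p] of its symbol [sym p] into [out p]. *)
Section Relabeling.
Variables (B B' : ralphabet) (P : finType) (sym : P -> B) (out : P -> B').
Variable look : P -> nat -> pred (tree void B).
Hypothesis rk_out : forall p, rk (out p) = rk (sym p).
Hypothesis look_regular : forall p i, i < rk (sym p) -> regular (look p i).
Hypothesis look_disjoint : forall p p', p != p' -> sym p = sym p' ->
  exists2 i, i < rk (sym p) & forall s, ~~ (look p i s && look p' i s).

Definition relabel_out p : tree (unit * nat) B' :=
  Node (out p) [seq Var (tt, i) | i <- iota 0 (rk (sym p))].

Lemma vars_relabel_out p :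
  vars (relabel_out p) = [seq (tt, i) | i <- iota 0 (rk (sym p))].
Proof. by rewrite /= -map_comp flatten_map1. Qed.

Lemma relabel_out_ranked p : well_ranked (@rk B') (relabel_out p).
Proof. by rewrite /= size_map size_iota rk_out eqxx all_map all_predT. Qed.

Lemma relabel_out_vars p : all (fun x => x.2 < rk (sym p)) (vars (relabel_out p)).
Proof.
by rewrite vars_relabel_out all_map; apply/allP => i; rewrite mem_iota.
Qed.

Lemma relabel_out_linear p : uniq (map snd (vars (relabel_out p))).
Proof. by rewrite vars_relabel_out -map_comp map_id iota_uniq. Qed.

Definition relabeling : ldtr B B' :=
  @LDTR B B' unit tt P (fun=> tt) sym (fun=> fun t => well_ranked (@rk B) t) look
    relabel_out (fun=> @well_ranked_regular B) look_regular relabel_out_ranked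
    relabel_out_vars relabel_out_linear
    (fun p p' ne _ Es => or_intror (look_disjoint ne Es)).

Lemma relabeling_node p ss ss' t0 t0' :
  well_ranked (@rk B) (Node (sym p) ss) -> size ss' = size ss ->
  (forall i, i < size ss -> look p i (nth t0 ss i)) ->
  (forall i, i < size ss ->
     transduces (M := relabeling) tt (nth t0 ss i) (nth t0' ss' i)) ->
  transduces (M := relabeling) tt (Node (sym p) ss) (Node (out p) ss').
Proof.
move=> wss sz lk tr; have /= /andP[/eqP sz' _] := wss.
have onthP i s : onth ss i = Some s -> i < size ss /\ s = nth t0 ss i.
  by elim: ss i {wss sz lk tr sz'} => [|s' ss IH] [|i] //=; [case=> ->|exact: IH].
pose f (x : unit * nat) := nth t0' ss' x.2.
have -> : Node (out p) ss' = bind f (relabel_out p).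
  rewrite /= -map_comp; congr Node; apply: (@eq_from_nth _ t0') => [|i].
    by rewrite size_map size_iota sz sz'.
  by rewrite sz sz' => ip; rewrite (nth_map 0) ?size_iota // nth_iota.
apply: (@Transduces _ _ relabeling p) => // [i s /onthP[il ->]|[] i s _ /onthP[il ->]].
  exact: lk.
exact: tr.
Qed.

End Relabeling.

(** * The string grammar *)

Section Construction.
Variables (A : ralphabet) (G : mcftg A).
(* [keep k i]: the piece w_i of a pattern of rank k is represented in the string
   grammar; the other pieces must be empty ([unkept] below). *)
Variable keep : nat -> nat -> bool.
Hypothesis keep0 : forall k, keep k 0.
Variable m : nat.
Hypothesis m_gt0 : 0 < m.

Notation N := (nt G).

(** Collected in one finite set so that nonterminal names and annotations range over finite
    types. *)
Definition orders : seq (seq nat) :=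
  flatten [seq permutations (iota 0 k) | k <- iota 0 (width G).+1].
Definition order := seq_sub orders.

(* The guessed left-to-right order of the variables in the pattern derived from
   each nonterminal. *)
Definition annotation := {ffun N -> option order}.

(* The start symbol [None], the pieces [Some (inl (C, o, i))] for the i-th
   piece of a pattern derived from C with variables in order o, and [m]
   dummies, which force the multiplicity to be exactly [m]. *)
Definition string_nt : ralphabet :=
  RAlphabet (fun x : option (N * option order * 'I_(width G).+1 + 'I_m) =>
    nat_of_bool (isSome x)).
Definition string_symbol := (string_nt + string_alphabet A)%type.

Implicit Types (a : annotation) (C : N) (t : tree nat (N + A)).

(* Annotations that are no permutation are read as the identity, so that every
   annotation yields well-formed rules. *)
Definition ord a C : seq nat :=
  let s := oapp val [::] (a C) in
  if perm_eq s (iota 0 (rk C)) then s else iota 0 (rk C).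

Definition piece_nt a C i : string_nt := Some (inl (C, a C, inord i)).

Definition kept C : seq nat := [seq i <- iota 0 (rk C).+1 | keep (rk C) i].

Definition big_pieces a (B : seq N) : seq string_nt :=
  [seq piece_nt a C i | C <- B, i <- kept C].

(** A terminal is treated like a nonterminal with the identity order whose only nonempty piece is
    the symbol itself, so that one weave in [enc] covers both kinds of nodes. *)
Definition sym_order a (x : N + A) : seq nat :=
  match x with inl C => ord a C | inr b => iota 0 (rk b) end.

Definition sym_piece a (x : N + A) i : seq (nat + string_symbol) :=
  match x with
  | inl C => if keep (rk C) i then [:: inr (inl (piece_nt a C i))] else [::]
  | inr b => if i is 0 then [:: inr (inr (Some b))] else [::]
  end.

Fixpoint enc a t : seq (nat + string_symbol) :=
  match t with
  | Var j => [:: inl j]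
  | Node x ts =>
      weave (sym_piece a x) (nth [::] (map (enc a) ts)) (sym_order a x) 0
  end.

Fixpoint lin (t : tree nat A) : seq (nat + string_alphabet A) :=
  match t with
  | Var j => [:: inl j]
  | Node b ts => inr (Some b) :: flatten (map lin ts)
  end.

Lemma rk_width C : rk C <= width G.
Proof. exact: leq_bigmax. Qed.

Lemma ord_perm a C : perm_eq (ord a C) (iota 0 (rk C)).
Proof. by rewrite /ord; case: ifP. Qed.

Lemma sym_order_perm a x : perm_eq (sym_order a x) (iota 0 (sum_rk x)).
Proof. by case: x => [C|b] //=; exact: ord_perm. Qed.

Lemma size_sym_order a x : size (sym_order a x) = sum_rk x.
Proof. by rewrite (perm_size (sym_order_perm a x)) size_iota. Qed.

Lemma mem_sym_order a x j : (j \in sym_order a x) = (j < sum_rk x).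
Proof. by rewrite (perm_mem (sym_order_perm a x)) mem_iota. Qed.

Lemma mem_order C s : perm_eq s (iota 0 (rk C)) -> s \in orders.
Proof.
move=> sC; apply/flattenP; exists (permutations (iota 0 (rk C))).
  by apply: (map_f (fun k => permutations (iota 0 k))); rewrite mem_iota ltnS rk_width.
by rewrite mem_permutations.
Qed.

Lemma insub_order C s : perm_eq s (iota 0 (rk C)) ->
  oapp val [::] (insub s : option order) = s.
Proof. by move/mem_order => sC; rewrite insubT. Qed.

Lemma kept_leq C i : i \in kept C -> i <= rk C.
Proof. by rewrite mem_filter mem_iota ltnS => /andP[]. Qed.

Lemma kept0 C : 0 \in kept C.
Proof. by rewrite mem_filter keep0 mem_iota. Qed.

(** [inord] is faithful up to [width G], which bounds every kept index. *)
Lemma piece_nt_inj a C i C' i' : i \in kept C -> i' \in kept C' ->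
  piece_nt a C i = piece_nt a C' i' -> C = C' /\ i = i'.
Proof.
move=> /kept_leq iC /kept_leq iC' [-> _] /(congr1 val).
by rewrite /= !inordK ?ltnS ?(leq_trans iC) ?(leq_trans iC') ?rk_width.
Qed.

Lemma big_piecesP a B x : reflect
  (exists C i, [/\ C \in B, i \in kept C & x = piece_nt a C i])
  (x \in big_pieces a B).
Proof. exact: allpairsPdep. Qed.

Lemma big_pieces_uniq a B : uniq B -> uniq (big_pieces a B).
Proof.
move=> uB; apply: allpairs_uniq_dep => // [C _|].
  by rewrite filter_uniq ?iota_uniq.
move=> [C i] [C' i'] /allpairsPdep[C1 [i1 [_ k1 [-> ->]]]].
move=> /allpairsPdep[C2 [i2 [_ k2 [-> ->]]]] /=.
by move/(piece_nt_inj k1 k2) => [-> ->].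
Qed.

(** Piece 0 is always kept, so each nonterminal of [B] leaves its name and its annotation in
    [big_pieces a B]. *)
Lemma big_pieces_sub a a' B B' : {subset big_pieces a B <= big_pieces a' B'} ->
  {in B, a =1 a'} /\ {subset B <= B'}.
Proof.
move=> sub; suff E C : C \in B -> a C = a' C /\ C \in B'.
  by split=> C /E[].
move=> CB; have /sub : piece_nt a C 0 \in big_pieces a B.
  by apply/big_piecesP; exists C, 0; rewrite kept0.
by case/big_piecesP=> C' [i' [CB' _ [EC Ea _]]]; rewrite Ea EC.
Qed.

Lemma big_pieces_inj a a' B B' : B \in bignt G -> B' \in bignt G ->
  big_pieces a B =i big_pieces a' B' -> B = B' /\ {in B, a =1 a'}.
Proof.
move=> HB HB' E.
have [aa BB'] : {in B, a =1 a'} /\ {subset B <= B'}.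
  by apply: big_pieces_sub => x; rewrite E.
have [_ B'B] : {in B', a' =1 a} /\ {subset B' <= B}.
  by apply: big_pieces_sub => x; rewrite E.
split=> //; apply: bignt_occ => // C.
by apply/idP/idP => [/BB'|/B'B].
Qed.

Lemma eq_big_pieces a a' B : {in B, a =1 a'} -> big_pieces a B = big_pieces a' B.
Proof.
move=> aa; apply/eq_in_allpairs_dep => C i CB _.
by rewrite /piece_nt aa.
Qed.

Lemma big_pieces_flatten a Bs :
  flatten (map (big_pieces a) Bs) = big_pieces a (flatten Bs).
Proof. by elim: Bs => //= B Bs ->; rewrite /big_pieces allpairs_cat. Qed.

(** * Symbol counts and unique decodability of encodings *)

Definition sym_labels a (x : N + A) : seq string_symbol :=
  match x with
  | inl C => [seq inl (piece_nt a C i) | i <- kept C]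
  | inr b => [:: inr (Some b)]
  end.

Lemma map_sym_order (T : eqType) a x (f : nat -> seq T) :
  perm_eq (flatten (map f (sym_order a x))) (flatten (map f (iota 0 (sum_rk x)))).
Proof. exact/perm_flatten/perm_map/sym_order_perm. Qed.

Lemma enc_pmap (T : eqType) (g : nat + string_symbol -> option T) a x ts :
  size ts = sum_rk x ->
  perm_eq (pmap g (enc a (Node x ts)))
    (flatten [seq pmap g (sym_piece a x l) | l <- iota 0 (sum_rk x).+1]
     ++ flatten [seq pmap g (enc a t) | t <- ts]).
Proof.
move=> sz; apply: perm_trans (perm_pmap_weave _ _ _ _ _) _.
rewrite size_sym_order perm_cat2l.
apply: perm_trans (map_sym_order _ _ _) _.
rewrite -{1}sz -{1}(size_map (enc a)) (map_comp (pmap g)) map_nth_iota0 //.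
by rewrite take_size -map_comp.
Qed.

Lemma flatten_sym_piece a x :
  flatten [seq syms (sym_piece a x l) | l <- iota 0 (sum_rk x).+1] =
  sym_labels a x.
Proof.
case: x => [C|b].
  rewrite /sym_labels /kept [sum_rk _]/=; elim: (iota _ _) => //= i s IH.
  by case: ifP => //= _; rewrite IH.
rewrite /=; have : all (leq 1) (iota 1 (rk b)).
  by apply/allP=> i; rewrite mem_iota => /andP[].
by elim: (iota _ _) => //= -[|i] s IH //= /IH.
Qed.

Lemma enc_evars a t : well_ranked (@sum_rk N A) t ->
  perm_eq (evars (enc a t)) (vars t).
Proof.
elim/tree_each_ind: t => // x ts IH /= /andP[/eqP sz wts].
apply: perm_trans (enc_pmap _ a sz) _; rewrite -/evars.
have -> : flatten [seq evars (sym_piece a x l) | l <- iota 0 (sum_rk x).+1] = [::].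
  elim: (iota _ _) => //= l s ->.
  by case: x {sz} => [C|b] /=; [case: ifP|case: l].
elim: ts IH wts {sz} => //= t ts IHts [Pt Pts] /andP[wt wts].
by rewrite perm_cat ?Pt // IHts.
Qed.

Lemma enc_syms a t : well_ranked (@sum_rk N A) t ->
  perm_eq (syms (enc a t)) (flatten (map (sym_labels a) (labels t))).
Proof.
elim/tree_each_ind: t => // x ts IH /= /andP[/eqP sz wts].
apply: perm_trans (enc_pmap _ a sz) _; rewrite -/syms flatten_sym_piece perm_cat2l.
elim: ts IH wts {sz} => //= t ts IHts [Pt Pts] /andP[wt wts].
by rewrite map_cat flatten_cat perm_cat ?Pt // IHts.
Qed.

Lemma enc_node a x ts : exists w, enc a (Node x ts) =
  inr (match x with inl C => inl (piece_nt a C 0) | inr b => inr (Some b) end) :: w.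
Proof. by rewrite /=; case: (sym_order a x) => [|j s]; case: x => [C|b] /=;
  rewrite ?keep0; eexists. Qed.

(** The first letter of a code is a variable or names the root label, as piece 0 is kept. Under a
    fixed annotation the label determines the separators and the order of the children, whose codes
    are then peeled off by [weave_inj]. *)
Lemma enc_prefix a t t' z z' :
  well_ranked (@sum_rk N A) t -> well_ranked (@sum_rk N A) t' ->
  enc a t ++ z = enc a t' ++ z' -> t = t' /\ z = z'.
Proof.
elim/tree_each_ind: t t' z z' => [j|x ts IH] [j'|x' ts'] z z'.
- by move=> _ _ [-> ->].
- by move=> _ _; have [w ->] := enc_node a x' ts'.
- by move=> _ _; have [w ->] := enc_node a x ts.
move=> wt wt' E; have Ex : x = x'.
  move: E; have [w ->] := enc_node a x ts; have [w' ->] := enc_node a x' ts'.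
  by move: x x' {IH wt wt'} => [C|b] [C'|b'] //= [-> _].
move: wt wt' E; rewrite -{}Ex {x'} /= => /andP[/eqP sz wts] /andP[/eqP sz' wts'].
case/(@weave_inj _ (fun j => nth (Var 0) ts j = nth (Var 0) ts' j)).
  move=> j y y'; rewrite mem_sym_order => jx.
  rewrite !(nth_map (Var 0)) ?sz ?sz' //.
  apply: (Each_nth (Var 0) (i := j) IH); rewrite ?sz //.
    by apply/(all_nthP (Var 0)); rewrite ?sz.
  by apply/(all_nthP (Var 0)); rewrite ?sz'.
move=> Ets ->; split=> //; congr Node; apply: (@eq_from_nth _ (Var 0)) => [|j].
  by rewrite sz sz'.
by rewrite sz => jx; apply: Ets; rewrite mem_sym_order.
Qed.

Lemma enc_inj a t t' :
  well_ranked (@sum_rk N A) t -> well_ranked (@sum_rk N A) t' ->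
  enc a t = enc a t' -> t = t'.
Proof.
move=> wt wt' E; have [] := @enc_prefix a t t' [::] [::] => //.
by rewrite E.
Qed.

(** * Annotated rules and their well-formedness *)

Implicit Types (r : rule G).

Definition component r C : tree nat (N + A) :=
  nth (Var 0) (rhs r) (index C (lhs r)).

Lemma lhs_uniq r : uniq (lhs r).
Proof. exact/bignt_uniq/lhs_bignt. Qed.

Lemma size_rhs r : size (rhs r) = size (lhs r).
Proof. by have := rhs_pattern r; rewrite all2E => /andP[/eqP]. Qed.

Lemma rhs_component r : rhs r = map (component r) (lhs r).
Proof.
apply: (@eq_from_nth _ (Var 0)) => [|i]; rewrite ?size_map size_rhs // => il.
by rewrite (nth_map (start G)) // /component index_uniq ?lhs_uniq.
Qed.

Lemma component_pattern r C : C \in lhs r ->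
  is_pattern (@sum_rk N A) (rk C) (component r C).
Proof.
move=> Cr; have := rhs_pattern r; rewrite all2E => /andP[_].
have Ci : index C (lhs r) < size (lhs r) by rewrite index_mem.
move/(all_nthP (start G, Var 0))/(_ (index C (lhs r))).
rewrite size_zip size_rhs minnn => /(_ Ci).
by rewrite nth_zip ?size_rhs //= nth_index.
Qed.

Lemma component_evars a r C : C \in lhs r ->
  perm_eq (evars (enc a (component r C))) (iota 0 (rk C)).
Proof.
move/component_pattern/andP=> [wt pt].
exact: perm_trans (enc_evars a wt) pt.
Qed.

Lemma component_size_evars a r C : C \in lhs r ->
  size (evars (enc a (component r C))) = rk C.
Proof. by move/(component_evars a)/perm_size ->; rewrite size_iota. Qed.

(** Demanded for every annotation, also for those that no derivation tree produces, because every
    supported annotation yields a rule of the string grammar. *)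
Hypothesis unkept : forall a r C i, C \in lhs r -> i <= rk C ->
  ~~ keep (rk C) i -> piece i (enc a (component r C)) = [::].

Lemma flatten_kept a r C : C \in lhs r ->
  flatten [seq piece i (enc a (component r C)) | i <- kept C] =
  syms (enc a (component r C)).
Proof.
move=> Cr; rewrite -flatten_pieces (component_size_evars a Cr) /kept.
have : all (fun i => i <= rk C) (iota 0 (rk C).+1).
  by apply/allP => i; rewrite mem_iota.
elim: (iota _ _) => //= i s IH /andP[iC /IH <-].
by case: ifP => //= /negbT /unkept ->.
Qed.

(** A normal form: annotations that differ only outside the links would give the same left-hand
    side, right-hand side and links, contradicting [rule_inj]. *)
Definition supported (x : rule G * annotation) : bool :=
  [forall C, (C \in flatten (links x.1)) || (x.2 C == None)].
Definition string_rule := {x : rule G * annotation | supported x}.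
Implicit Type x : string_rule.

(* The orders of the variables in the components of [r], given those in the
   patterns derived from the nonterminals on its right-hand side. *)
Definition infer r a : annotation :=
  [ffun C => if C \in lhs r then insub (evars (enc a (component r C))) else None].

Lemma inferE r a C : C \in lhs r ->
  oapp val [::] (infer r a C) = evars (enc a (component r C)).
Proof.
move=> Cr; rewrite ffunE Cr; apply: insub_order (component_evars a Cr).
Qed.

Definition string_lhs x : seq string_nt :=
  if initial (val x).1 then [:: None]
  else big_pieces (infer (val x).1 (val x).2) (lhs (val x).1).

(** The end marker enters only through initial rules. Their single component has rank 0, so its
    whole word is piece 0; all other lines end in a variable and have rank 1. *)
Definition string_rhs x : seq (tree nat string_symbol) :=
  let: (r, a) := val x in
  if initial r
  then [:: line (Node (inr None) [::])
             (piece 0 (enc a (component r (start G))))]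
  else [seq line (Var 0) (piece i (enc a (component r C)))
       | C <- lhs r, i <- kept C].

Definition string_links x : seq (seq string_nt) :=
  map (big_pieces (val x).2) (links (val x).1).

Definition dummies : seq string_nt := [seq Some (inr i) | i : 'I_m].

Definition string_bignt : seq (seq string_nt) :=
  [:: None] :: dummies ::
  [seq big_pieces a B | B <- bignt G, a <- enum {: annotation}].

Lemma string_bigntP (B' : seq string_nt) : reflect
  [\/ B' = [:: None], B' = dummies
    | exists2 B, B \in bignt G & exists a, B' = big_pieces a B]
  (B' \in string_bignt).
Proof.
rewrite !inE; apply: (iffP or3P) => -[/eqP|/eqP|] H;
  first [by constructor 1|by constructor 2|constructor 3].
- by case/allpairsP: H => -[B a] /= [HB _ ->]; exists B => //; exists a.
- by case: H => B HB [a ->]; apply/allpairsP; exists (B, a); rewrite mem_enum.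
Qed.

Lemma string_rhs_labels x :
  forest_labels (string_rhs x) =
  flatten [seq syms (enc (val x).2 (component (val x).1 C)) | C <- lhs (val x).1]
  ++ (if initial (val x).1 then [:: inr None] else [::]).
Proof.
rewrite /string_rhs; case: (val x) => r a /=; rewrite /forest_labels.
case: ifP => [/eqP rS|_].
  rewrite rS /= labels_line /= !cats0.
  have Sr : start G \in lhs r by rewrite rS inE.
  have := component_evars a Sr; rewrite start_rk => /perm_nilP/evars_nil {2}->.
  by elim: (piece _ _) => //= y w ->.
rewrite cats0; have : {subset lhs r <= lhs r} by [].
elim: {1 3 4}(lhs r) => //= C Cs IH sub.
rewrite map_cat flatten_cat IH => [|D Ds]; last by apply: sub; rewrite inE Ds orbT.
rewrite -flatten_kept ?sub ?mem_head // -map_comp; congr (flatten _ ++ _).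
by apply: eq_map => i; rewrite /= labels_line cats0.
Qed.

(** Encoding only permutes the symbols and splits each nonterminal into its kept pieces. Uniqueness
    of nonterminals, covering by links, start-separation and lexicalization all follow from this
    count. *)
Lemma string_rhs_perm x :
  perm_eq (forest_labels (string_rhs x))
    (flatten (map (sym_labels (val x).2) (forest_labels (rhs (val x).1)))
     ++ (if initial (val x).1 then [:: inr None] else [::])).
Proof.
rewrite string_rhs_labels perm_cat2r; case: (val x) => r a /=.
rewrite rhs_component; have : {subset lhs r <= lhs r} by [].
elim: {1 3 4}(lhs r) => //= C Cs IH sub.
rewrite /forest_labels /= map_cat flatten_cat perm_cat ?IH //.
  by apply: enc_syms; have /sub/component_pattern/andP[] := mem_head C Cs.
by move=> D Ds; apply: sub; rewrite inE Ds orbT.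
Qed.

Lemma string_nonterminals x :
  perm_eq (nonterminals (string_rhs x))
    (big_pieces (val x).2 (nonterminals (rhs (val x).1))).
Proof.
apply: perm_trans (perm_pmap _ (string_rhs_perm x)) _.
rewrite pmap_cat; case: (val x) => r a /=.
have -> : pmap (fun y : string_symbol => if y is inl C then Some C else None)
   (if initial r then [:: inr None] else [::]) = [::] by case: ifP.
rewrite cats0 /nonterminals /big_pieces.
elim: (forest_labels (rhs r)) => //= -[C|b] w IH //=.
rewrite -(perm_cat2l [seq piece_nt a C i | i <- kept C]) in IH.
rewrite pmap_cat; apply: perm_trans IH; rewrite perm_cat2r.
by elim: (kept C) => //= i s IHs; rewrite perm_cons.
Qed.

Lemma dummies_piece y : Some (inl y) \notin dummies.
Proof. by apply/negP => /mapP[]. Qed.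

Lemma dummies_start : None \notin dummies.
Proof. by apply/negP => /mapP[]. Qed.

Lemma size_dummies : size dummies = m.
Proof. by rewrite size_map -cardE card_ord. Qed.

Lemma big_pieces_neq0 a B : B \in bignt G -> big_pieces a B != [::].
Proof.
move/bignt_neq0; case: B => // C B _; apply/eqP => E.
have : piece_nt a C 0 \in big_pieces a (C :: B).
  by apply/big_piecesP; exists C, 0; rewrite mem_head kept0.
by rewrite E.
Qed.

Lemma big_pieces_start a B : None \notin big_pieces a B.
Proof. by apply/negP => /big_piecesP[C [i [_ _]]]. Qed.

Lemma big_pieces_dummies a B : B \in bignt G -> ~ big_pieces a B =i dummies.
Proof.
move/(big_pieces_neq0 a); case E: (big_pieces a B) => [//|y s] _ /(_ y).
rewrite mem_head; have : y \in big_pieces a B by rewrite E mem_head.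
by case/big_piecesP=> C [i [_ _ ->]]; rewrite (negbTE (dummies_piece _)).
Qed.

Lemma string_terminal_mr :
  [exists b : string_alphabet A, 0 < rk b].
Proof.
have /existsP[b _] := terminal_mr G.
by apply/existsP; exists (Some b).
Qed.

Lemma string_bignt_neq0 (B : seq string_nt) : B \in string_bignt -> B != [::].
Proof.
case/string_bigntP=> [->|->|[B0 HB [a ->]]] //; last exact: big_pieces_neq0.
by rewrite -size_eq0 size_dummies -lt0n.
Qed.

Lemma string_bignt_uniq (B : seq string_nt) : B \in string_bignt -> uniq B.
Proof.
case/string_bigntP=> [->|->|[B0 HB [a ->]]] //.
  by rewrite map_inj_uniq ?enum_uniq // => i j [].
exact/big_pieces_uniq/bignt_uniq.
Qed.

Lemma string_bignt_occ (B B' : seq string_nt) :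
  B \in string_bignt -> B' \in string_bignt -> B =i B' -> B = B'.
Proof.
have start_mem (D : seq string_nt) : D \in string_bignt -> None \in D -> D = [:: None].
  case/string_bigntP=> [->|->|[B0 _ [a ->]]] //.
    by rewrite (negbTE dummies_start).
  by rewrite (negbTE (big_pieces_start _ _)).
move=> HB HB' E; case/string_bigntP: (HB) (E) => [->|->|[B0 HB0 [a ->]]] {}E.
- by rewrite (start_mem B') // -E inE.
- case/string_bigntP: (HB') (E) => [->|->|[B1 HB1 [a ->]]] {}E //.
    by have := E None; rewrite inE (negbTE dummies_start).
  by case: (@big_pieces_dummies a B1).
- case/string_bigntP: (HB') (E) => [->|->|[B1 HB1 [a1 ->]]] {}E //.
  + by have := E None; rewrite inE (negbTE (big_pieces_start _ _)).
  + by case: (@big_pieces_dummies a B0).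
  + by case: (big_pieces_inj HB0 HB1 E) => <- /eq_big_pieces ->.
Qed.

Lemma string_start_bignt : [:: None] \in string_bignt.
Proof. by rewrite inE eqxx. Qed.

Lemma string_start_rk : rk (None : string_nt) = 0.
Proof. by []. Qed.

Lemma string_lhs_inj x x' : string_lhs x = string_lhs x' ->
  lhs (val x).1 = lhs (val x').1 /\
  (~~ initial (val x).1 ->
   {in lhs (val x).1, infer (val x).1 (val x).2 =1 infer (val x').1 (val x').2}).
Proof.
rewrite /string_lhs; case: ifP => [/eqP-> |i]; case: ifP => [/eqP->|i'] // E.
- have := big_pieces_start (infer (val x').1 (val x').2) (lhs (val x').1).
  by rewrite -E inE eqxx.
- have := big_pieces_start (infer (val x).1 (val x).2) (lhs (val x).1).
  by rewrite E inE eqxx.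
case: (@big_pieces_inj
  (infer (val x).1 (val x).2) (infer (val x').1 (val x').2)
  (lhs (val x).1) (lhs (val x').1)) => //; rewrite ?lhs_bignt // => y.
by rewrite E.
Qed.

(** On the nonterminals of the links the annotation is legible from their names; everywhere else it
    is [None] by [supported]. *)
Lemma string_links_inj x x' : string_links x =i string_links x' ->
  links (val x).1 =i links (val x').1 /\ (val x).2 = (val x').2.
Proof.
have sub y y' : string_links y =i string_links y' ->
    forall B, B \in links (val y).1 ->
    B \in links (val y').1 /\ {in B, (val y).2 =1 (val y').2}.
  move=> E B HB; have := E (big_pieces (val y).2 B).
  rewrite map_f //; case/esym/mapP=> B' HB' EB.
  case: (@big_pieces_inj (val y).2 (val y').2 B B'); rewrite ?EB //.
  - exact: (links_bignt HB).
  - exact: (links_bignt HB').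
  - by move=> ->.
move=> E; have E' : string_links x' =i string_links x by move=> y; rewrite E.
have El : links (val x).1 =i links (val x').1.
  by move=> B; apply/idP/idP => [/(sub _ _ E)[]|/(sub _ _ E')[]].
split=> //; apply/ffunP => C.
have [/flattenP[B HB CB]|nC] := boolP (C \in flatten (links (val x).1)).
  by have [_ ->] := sub _ _ E B HB.
have nC' : C \notin flatten (links (val x').1).
  apply: contra nC => /flattenP[B HB CB]; apply/flattenP.
  by exists B; rewrite ?El.
have /forallP/(_ C) := valP x; rewrite (negbTE nC) /= => /eqP ->.
by have /forallP/(_ C) := valP x'; rewrite (negbTE nC') /= => /eqP ->.
Qed.

(** The links give back the annotation, the left-hand side the variable order of each component, and
    the right-hand side its kept pieces; the other pieces are empty. This determines the encoded
    word, and [enc] is injective for a fixed annotation. *)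
Lemma string_rule_inj x x' : string_lhs x = string_lhs x' ->
  string_rhs x = string_rhs x' -> string_links x =i string_links x' -> x = x'.
Proof.
move=> /string_lhs_inj[El Ei] Er /string_links_inj[Ek Ea].
apply/val_inj; rewrite [LHS]surjective_pairing [RHS]surjective_pairing Ea.
congr pair; apply: rule_inj Ek => //.
move: El Ei Er; rewrite /string_rhs.
case: (val x) (val x') Ea => [r a] [r' a'] /= {x x'} <-.
move=> El Ei; rewrite !rhs_component -El {1 2}/initial -El -/(initial r).
suff main : {in lhs r, forall C,
    evars (enc a (component r C)) = evars (enc a (component r' C)) /\
    {in kept C, forall i, piece i (enc a (component r C)) =
                          piece i (enc a (component r' C))}} ->
    map (component r) (lhs r) = map (component r') (lhs r).
  move=> Er; apply: main => C Cr; have Cr' : C \in lhs r' by rewrite -El.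
  (* The component of an initial rule has rank 0: there is no order to recover, and piece 0 is the
     whole word. *)
  case: ifP Er => [/eqP rS|/negbT i] Er.
    move: Cr Cr'; rewrite {1}rS inE => /eqP -> Sr'.
    have Sr : start G \in lhs r by rewrite rS inE.
    have := component_evars a Sr; have := component_evars a Sr'.
    rewrite start_rk => /perm_nilP -> /perm_nilP ->; split=> // i.
    move/kept_leq; rewrite start_rk leqn0 => /eqP ->.
    by case: Er => /line_inj.
  split.
    by have := Ei i _ Cr => /(congr1 (oapp val [::])); rewrite !inferE.
  move=> l lC; apply: (@line_inj _ _ (Var 0)).
  exact: (allpairs_eq_in Er).
move=> H; apply/eq_in_map => C Cr; have Cr' : C \in lhs r' by rewrite -El.
have [Ev Ep] := H C Cr.
have /andP[wt _] := component_pattern Cr; have /andP[wt' _] := component_pattern Cr'.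
apply: (enc_inj wt wt'); apply: (eq_words Ev) => i.
rewrite component_size_evars // => iC.
have [k|k] := boolP (keep (rk C) i); last by rewrite !unkept.
by apply: Ep; rewrite mem_filter k mem_iota.
Qed.

Lemma string_lhs_bignt x : string_lhs x \in string_bignt.
Proof.
rewrite /string_lhs; case: ifP => _; first exact: string_start_bignt.
apply/string_bigntP; constructor 3; exists (lhs (val x).1); first exact: lhs_bignt.
by eexists.
Qed.

Lemma enc_rk a t i : well_ranked (@sum_rk N A) t ->
  all (fun y => sum_rk y == 1) (piece i (enc a t)).
Proof.
move=> wt; apply: all_piece; rewrite (perm_all _ (enc_syms a wt)).
elim: (labels t) => //= -[C|b] w IH; rewrite all_cat IH ?andbT //=.
by elim: (kept C).
Qed.

Lemma well_ranked_line (z : tree nat string_symbol) w :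
  well_ranked (@sum_rk string_nt (string_alphabet A)) z ->
  all (fun y => sum_rk y == 1) w ->
  well_ranked (@sum_rk string_nt (string_alphabet A)) (line z w).
Proof. by move=> wz; elim: w => //= y w IH /andP[/eqP -> /IH ->]. Qed.

Lemma string_rhs_pattern x :
  all2 (fun (D : string_nt) v =>
      is_pattern (@sum_rk string_nt (string_alphabet A)) (rk D) v)
    (string_lhs x) (string_rhs x).
Proof.
rewrite /string_lhs /string_rhs; case: (val x) => r a /=.
case: ifP => [/eqP rS|_].
  have Sr : start G \in lhs r by rewrite rS inE.
  rewrite /= andbT /is_pattern vars_line /= andbT well_ranked_line //.
  by apply: enc_rk; have /andP[] := component_pattern Sr.
rewrite /big_pieces all2E !size_allpairs_dep eqxx /=.
have : {subset lhs r <= lhs r} by [].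
elim: {1 3 4}(lhs r) => //= C Cs IH sub.
rewrite zip_cat ?size_map // all_cat IH => [|D Ds]; last first.
  by apply: sub; rewrite inE Ds orbT.
rewrite andbT; elim: (kept C) => //= i s ->.
rewrite andbT /is_pattern vars_line /= andbT well_ranked_line //.
by apply: enc_rk; have /sub/component_pattern/andP[] := mem_head C Cs.
Qed.

Lemma string_rhs_uniq x : uniq (nonterminals (string_rhs x)).
Proof.
rewrite (perm_uniq (string_nonterminals x)).
exact/big_pieces_uniq/rhs_uniq.
Qed.

Lemma string_links_uniq x : uniq (string_links x).
Proof.
rewrite map_inj_in_uniq ?links_uniq // => B B' HB HB' E.
case: (@big_pieces_inj (val x).2 (val x).2 B B') => //; rewrite ?E //.
  exact: (links_bignt HB).
exact: (links_bignt HB').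
Qed.

Lemma string_links_bignt x : {subset string_links x <= string_bignt}.
Proof.
move=> _ /mapP[B HB ->]; apply/string_bigntP; constructor 3.
by exists B; [exact: (links_bignt HB)|eexists].
Qed.

Lemma string_links_disjoint x (B B' : seq string_nt) :
  B \in string_links x -> B' \in string_links x -> B != B' -> [disjoint B & B'].
Proof.
move=> /mapP[B0 HB ->] /mapP[B1 HB' ->] ne.
have ne' : B0 != B1 by apply: contraNneq ne => ->.
apply/pred0P => y; apply/negP => /andP[/big_piecesP[C [i [CB _ ->]]]].
case/big_piecesP => C' [i' [CB' _ [EC _ _]]].
have /pred0P/(_ C) := links_disjoint HB HB' ne'.
by rewrite /= CB EC CB'.
Qed.

Lemma string_links_cover x :
  flatten (string_links x) =i nonterminals (string_rhs x).
Proof.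
move=> y; rewrite big_pieces_flatten (perm_mem (string_nonterminals x)).
by apply/big_piecesP/big_piecesP => -[C [i [CB Ci ->]]]; exists C, i;
  split=> //; rewrite ?links_cover // -links_cover.
Qed.

Lemma string_start_separated x : None \notin nonterminals (string_rhs x).
Proof.
rewrite (perm_mem (string_nonterminals x)); exact: big_pieces_start.
Qed.

Definition string_grammar : mcftg (string_alphabet A) :=
  MCFTG string_terminal_mr string_bignt_neq0 string_bignt_uniq string_bignt_occ
    string_start_bignt string_start_rk string_rule_inj string_lhs_bignt
    string_rhs_pattern string_rhs_uniq string_links_uniq string_links_bignt
    string_links_disjoint string_links_cover string_start_separated.

(** * Lexicalization, rule-width and multiplicity *)

Lemma string_is_mcfg : is_mcfg string_grammar.
Proof. by case. Qed.

Lemma string_initial x : @initial _ string_grammar x = initial (val x).1.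
Proof.
rewrite {1}/initial /= /string_lhs; case: ifP => _; first exact/eqP.
apply/eqP => E; have := big_pieces_start (infer (val x).1 (val x).2) (lhs (val x).1).
by rewrite E inE.
Qed.

Lemma string_lexicalized (D : {set A}) :
  lexicalized G D -> lexicalized string_grammar [set Some b | b in D].
Proof.
move=> lexG x; rewrite /Defs.proper string_initial /terminal /= /string_links.
rewrite -size_eq0 size_map size_eq0 => /lexG/existsP[b /andP[bD br]].
apply/existsP; exists (Some b); rewrite imset_f //=.
rewrite (perm_mem (string_rhs_perm x)) mem_cat; apply/orP; left.
by apply/flatten_mapP; exists (inr b); rewrite ?inE.
Qed.

Lemma supported_none r : supported (r, [ffun=> None]).
Proof. by apply/forallP => C; rewrite ffunE eqxx orbT. Qed.

Lemma string_rule_width : rule_width string_grammar = rule_width G.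
Proof.
apply/eqP; rewrite eqn_leq; apply/andP; split; apply/bigmax_leqP => /= x _.
  rewrite size_map; exact: (leq_bigmax (F := fun r => size (links r)) (val x).1).
(* Every rule of [G] has at least one annotated copy, for instance the one annotated by [None]
   throughout. *)
have := leq_bigmax (F := fun x : rule string_grammar => size (links x))
  (exist (fun y => supported y) _ (supported_none x)).
by rewrite /= size_map.
Qed.

(** The hypothesis gives the upper bound; [dummies] attains it. *)
Lemma string_multiplicity :
  (forall B a, B \in bignt G -> size (big_pieces a B) <= m) ->
  multiplicity string_grammar = m.
Proof.
move=> le_m; apply/eqP; rewrite eqn_leq; apply/andP; split.
  apply/bigmax_leqP_seq => B + _.
  by case/string_bigntP=> [->|->|[B0 HB [a ->]]]; rewrite ?size_dummies ?le_m.
rewrite -{1}size_dummies; apply: (leq_bigmax_seq (F := size)) => //.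
by rewrite !inE eqxx orbT.
Qed.

(** * Derivation trees and their values *)

Implicit Types (d : tree void (rules G)) (e : tree void (rules string_grammar)).

Definition link_index r C : nat := find (fun B : seq N => C \in B) (links r).

Lemma link_index_nth r i C : i < size (links r) ->
  C \in nth [::] (links r) i -> link_index r C = i.
Proof.
move=> il Ci; rewrite /link_index.
have hasC : has (fun B : seq N => C \in B) (links r).
  by apply/hasP; exists (nth [::] (links r) i); rewrite ?mem_nth.
have jl := hasC; rewrite has_find in jl.
have Cj := nth_find [::] hasC; apply/eqP; rewrite -(nth_uniq [::] jl il (links_uniq r)).
apply/negPn/negP => ne.
have /pred0P/(_ C) := links_disjoint (mem_nth [::] jl) (mem_nth [::] il) ne.
by rewrite /= Cj Ci.
Qed.

Lemma link_index_lt r C : C \in flatten (links r) ->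
  link_index r C < size (links r) /\ C \in nth [::] (links r) (link_index r C).
Proof.
move=> /flattenP[B HB CB].
have hasC : has (fun B : seq N => C \in B) (links r) by apply/hasP; exists B.
split; first by rewrite /link_index -has_find.
exact: (nth_find [::] hasC).
Qed.

Definition no_order : annotation := [ffun=> None].

(** Links are disjoint, so exactly one child is responsible for each of their nonterminals; [None]
    elsewhere makes the result [supported]. *)
Definition combine r (cs : seq annotation) : annotation :=
  [ffun C => if C \in flatten (links r) then nth no_order cs (link_index r C) C
             else None].

Lemma combine_supported r cs : supported (r, combine r cs).
Proof. by apply/forallP => C; rewrite ffunE /=; case: (C \in _). Qed.

Definition annotated_rule r cs : rule string_grammar :=
  exist (fun y => supported y) (r, combine r cs) (combine_supported r cs).

Lemma combine_nth r cs i C : i < size (links r) ->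
  C \in nth [::] (links r) i -> combine r cs C = nth no_order cs i C.
Proof.
move=> il Ci; rewrite ffunE (link_index_nth il Ci) ifT //.
by apply/flattenP; exists (nth [::] (links r) i); rewrite ?mem_nth.
Qed.

(** It depends on a subtree only through the root rule and the annotations of the children, hence is
    the run of a finite bottom-up automaton; this makes the look-ahead regular. *)
Fixpoint annot d : annotation :=
  match d with
  | Var _ => no_order
  | Node r ds => infer r (combine r (map annot ds))
  end.

Fixpoint encode d : tree void (rules string_grammar) :=
  match d with
  | Var v => Var v
  | Node r ds => @Node void (rules string_grammar)
      (annotated_rule r (map annot ds)) (map encode ds)
  end.

Fixpoint decode e : tree void (rules G) :=
  match e with
  | Var v => Var v
  | Node x es => @Node void (rules G) (val x).1 (map decode es)
  end.

Lemma derivation_well_ranked (A' : ralphabet) (G' : mcftg A')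
    (d : tree void (rules G')) B :
  derivation d B -> well_ranked (@rk (rules G')) d.
Proof.
elim/tree_each_ind: d B => // r ds IH B /= /andP[_ dl].
have := dl; rewrite all2E => /andP[-> _] /=.
elim: ds (links r) IH dl => //= d ds IHds [|L Ls] // [Pd Pds] /andP[dL dsL].
by rewrite (Pd _ dL) (IHds _ Pds dsL).
Qed.

Definition string_big (a : annotation) (B : seq N) : seq string_nt :=
  if B == [:: start G] then [:: None] else big_pieces a B.

Lemma link_not_start r B : B \in links r -> B != [:: start G].
Proof.
move=> HB; apply: contraNneq (start_separated r) => EB.
by rewrite -links_cover; apply/flattenP; exists B; rewrite // EB inE.
Qed.

Lemma string_big_link a r B : B \in links r -> string_big a B = big_pieces a B.
Proof. by move=> HB; rewrite /string_big (negbTE (link_not_start HB)). Qed.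

Lemma string_big_inj a a' B B' : B \in bignt G -> B' \in bignt G ->
  string_big a B = string_big a' B' ->
  B = B' /\ (B != [:: start G] -> {in B, a =1 a'}).
Proof.
move=> HB HB'; rewrite /string_big; case: eqP => [->|_]; case: eqP => [-> //|_].
- by move=> E; have := big_pieces_start a' B'; rewrite -E inE eqxx.
- by move=> E; have := big_pieces_start a B; rewrite E inE eqxx.
by move=> E; case: (@big_pieces_inj a a' B B') => // y; rewrite E.
Qed.

Lemma encode_derivation d B : derivation d B ->
  derivation (encode d) (string_big (annot d) B).
Proof.
elim/tree_each_ind: d B => // r ds IH B /= /andP[/eqP lr].
set d0 := Node r ds.
move=> /(all2_nthP _ _ _ d0 [::])[sz dn].
apply/andP; split; first by rewrite /string_lhs /string_big /initial lr.
apply/(all2_nthP _ _ _ (encode d0) [::]); rewrite /string_links !size_map.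
split=> // i il; rewrite (nth_map d0) ?sz // (nth_map [::]) //=.
have := Each_nth d0 (i := i) IH; rewrite sz => /(_ il _ (dn i il)).
rewrite (string_big_link _ (mem_nth _ il)); congr derivation.
apply: eq_big_pieces => C Ci.
by rewrite (combine_nth _ il Ci) (nth_map d0) ?sz.
Qed.

(** A child can be attached only if its left-hand side is spelled like the link, and that spelling
    contains the inferred orders. So the guesses of every rule are forced, and erasing them loses
    nothing. The start symbol carries no annotation, whence the proviso in the last claim. *)
Lemma decode_derivation e a B : B \in bignt G -> derivation e (string_big a B) ->
  [/\ derivation (decode e) B, encode (decode e) = e
    & B != [:: start G] -> {in B, annot (decode e) =1 a}].
Proof.
elim/tree_each_ind: e a B => // x es IH a B HB /= /andP[/eqP lx].
set e0 := Node x es; move=> /(all2_nthP _ _ _ e0 [::])[].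
rewrite size_map => sz en.
have Ei i : i < size (links (val x).1) ->
    [/\ derivation (decode (nth e0 es i)) (nth [::] (links (val x).1) i),
        encode (decode (nth e0 es i)) = nth e0 es i
      & {in nth [::] (links (val x).1) i,
           annot (decode (nth e0 es i)) =1 (val x).2}].
  move=> il; have Hl := mem_nth [::] il.
  have := en i il; rewrite (nth_map [::]) // -(string_big_link _ Hl).
  have := Each_nth e0 (i := i) IH; rewrite sz => /(_ il _ _ (links_bignt Hl)) P.
  by case/P=> dd ee /(_ (link_not_start Hl)).
(* Inside the links the children dictate the annotation; outside, both sides are [None], the left
   one by [supported]. *)
have Ea : (val x).2 = combine (val x).1 (map annot (map decode es)).
  apply/ffunP => C; have [Cf|Cf] := boolP (C \in flatten (links (val x).1)).
    have [jl Cj] := link_index_lt Cf; have [_ _ <-] // := Ei _ jl.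
    rewrite (combine_nth _ jl Cj) (nth_map (decode e0)) ?size_map ?sz //.
    by rewrite (nth_map e0) ?sz.
  have /forallP/(_ C) := valP x; rewrite (negbTE Cf) /= => /eqP ->.
  by rewrite ffunE (negbTE Cf).
have lx' : string_big (infer (val x).1 (val x).2) (lhs (val x).1) = string_big a B.
  by rewrite -lx.
have [El Eal] := string_big_inj (lhs_bignt _) HB lx'.
split.
- rewrite El eqxx; apply/(all2_nthP _ _ _ (decode e0) [::]).
  rewrite size_map; split=> // i il; rewrite (nth_map e0) ?sz //.
  by case: (Ei i il).
- congr Node.
    by apply/val_inj; rewrite /= -Ea -surjective_pairing.
  apply: (@eq_from_nth _ e0) => [|i]; rewrite !size_map // sz => il.
  rewrite (nth_map (decode e0)) ?size_map ?sz // (nth_map e0) ?sz //.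
  by case: (Ei i il).
- by rewrite -Ea -El.
Qed.

(** * Values of derivation trees as words *)

Lemma evars_lin (t : tree nat A) : evars (lin t) = vars t.
Proof.
elim/tree_each_ind: t => // b ts IH /=.
elim: ts IH => //= t ts IHts [Pt Pts].
by rewrite evars_cat Pt IHts.
Qed.

Lemma lin_bind (f : nat -> tree nat A) (t : tree nat A) :
  lin (bind f t) =
  flatten [seq match y with inl j => lin (f j) | inr b => [:: inr b] end | y <- lin t].
Proof.
elim/tree_each_ind: t => [j|b ts IH] /=; first by rewrite cats0.
congr cons; elim: ts IH => //= t ts IHts [Pt Pts].
by rewrite map_cat flatten_cat Pt IHts.
Qed.

Lemma lin_subst (sg : seq N) (u : seq (tree nat A)) a
    (h : string_symbol -> seq (string_alphabet A)) t :
  well_ranked (@sum_rk N A) t ->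
  (forall b, h (inr b) = [:: b]) ->
  (forall C, inl C \in labels t ->
     evars (lin (nth (Var 0) u (index C sg))) = ord a C /\
     forall i, i <= rk C -> piece i (lin (nth (Var 0) u (index C sg))) =
       if keep (rk C) i then h (inl (piece_nt a C i)) else [::]) ->
  lin (subst sg u t) = hom h (enc a t).
Proof.
move=> + hr; elim/tree_each_ind: t => // x ts IH /= /andP[/eqP sz wts] hC.
have IH' j : j < sum_rk x ->
    lin (subst sg u (nth (Var 0) ts j)) = hom h (nth [::] (map (enc a) ts) j).
  rewrite -sz => jx; rewrite (nth_map (Var 0)) //.
  apply: (Each_nth (Var 0) IH jx).
    by apply/(all_nthP (Var 0)).
  move=> C Cj; apply: hC; rewrite inE; apply/orP; right.
  apply/flattenP; exists (nth [::] (map (@labels _ _) ts) j).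
    by rewrite mem_nth ?size_map.
  by rewrite (nth_map (Var 0)).
rewrite hom_weave; case: x sz IH' hC => [C|b] sz IH' hC.
  have [Ev Ep] := hC C (mem_head _ _).
  rewrite lin_bind flatten_map_weave Ev.
  apply: eq_weave => [i|j].
    rewrite add0n (size_sym_order a (inl C)) /= => iC; rewrite flatten_map1 Ep //.
    by case: ifP => //= _; rewrite /hom /= cats0.
  rewrite (mem_sym_order a (inl C)) /= => jC.
  by rewrite (nth_map (Var 0)) ?sz // -IH'.
(* A terminal node in weave form: its symbol is piece 0 and all other separators are empty. *)
rewrite /= -[inr _ :: _]cat1s.
rewrite -[RHS](@eq_weave _ (fun i => if i is 0 then [:: inr (Some b)] else [::])
   _ (fun j => nth [::] (map lin (map (subst sg u) ts)) j)) => [|[|i] _|j].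
- rewrite weave_flatten (map_nth_iota0 [::]) ?size_map ?sz //.
  by rewrite take_oversize ?size_map ?sz.
- by rewrite /= /hom /= hr.
- by [].
rewrite (mem_sym_order a (inr b)) /= => jb.
by rewrite -IH' // -map_comp (nth_map (Var 0)) ?sz.
Qed.

Definition root_nts d : seq N := if d is Node r _ then lhs r else [::].

Definition value d C : tree nat A := nth (Var 0) (dval d) (index C (root_nts d)).

Lemma dval_value d B : derivation d B -> dval d = map (value d) B.
Proof.
case: d => // r ds /= /andP[/eqP <- _].
rewrite {1}rhs_component -map_comp; apply/eq_in_map => C Cr.
by rewrite /value /= (nth_map (Var 0)) // size_rhs index_mem.
Qed.

Definition link_value r ds C : tree nat A :=
  value (nth (Node r ds) ds (link_index r C)) C.

Lemma link_values r ds : all2 (@derivation A G) ds (links r) ->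
  flatten (map (@dval A G) ds) = map (link_value r ds) (flatten (links r)).
Proof.
move=> /(all2_nthP _ _ _ (Node r ds) [::])[sz dn].
rewrite map_flatten; congr flatten.
apply: (@eq_from_nth _ [::]) => [|i]; rewrite !size_map // sz => il.
rewrite (nth_map (Node r ds)) ?sz // (nth_map [::]) // (dval_value (dn i il)).
by apply/eq_in_map => C Ci; rewrite /link_value (link_index_nth il Ci).
Qed.

Lemma enc_mem_nt a t q : well_ranked (@sum_rk N A) t ->
  inl q \in syms (enc a t) ->
  exists C i, [/\ inl C \in labels t, i \in kept C & q = piece_nt a C i].
Proof.
move=> wt; rewrite (perm_mem (enc_syms a wt)) => /flatten_mapP[[C|b] Ct].
  by case/mapP=> i iC [->]; exists C, i.
by rewrite inE.
Qed.

Lemma component_links r C D : C \in lhs r ->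
  inl D \in labels (component r C) -> D \in flatten (links r).
Proof.
move=> Cr DC; rewrite links_cover /nonterminals mem_pmap.
apply/mapP; exists (inl D) => //; rewrite /forest_labels rhs_component.
by rewrite -map_comp; apply/flatten_mapP; exists C.
Qed.

Definition piece_trees (v : N -> tree nat A) (B : seq N) :
    seq (tree nat (string_alphabet A)) :=
  [seq line (Var 0) (piece i (lin (v C))) | C <- B, i <- kept C].

Definition start_trees (v : tree nat A) : seq (tree nat (string_alphabet A)) :=
  [:: line (Node None [::]) (piece 0 (lin v))].

(* The terminal word by which a symbol of an encoding is replaced when the
   nonterminals have the values [v]. *)
Definition expand (v : N -> tree nat A) (y : string_symbol) : seq (string_alphabet A) :=
  match y with
  | inl (Some (inl (C, _, i))) => piece i (lin (v C))
  | inl _ => [::]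
  | inr b => [:: b]
  end.

Lemma expand_piece v a C i : i <= rk C ->
  expand v (inl (piece_nt a C i)) = piece i (lin (v C)).
Proof. by move=> iC; rewrite /= inordK // ltnS (leq_trans iC) ?rk_width. Qed.

Lemma piece_trees_expand v v' a B : {in B, v =1 v'} ->
  piece_trees v B = [seq line (Var 0) (expand v' (inl q)) | q <- big_pieces a B].
Proof.
elim: B => // C B IH vv; rewrite /piece_trees /big_pieces /= map_cat.
rewrite -/(piece_trees v B) IH => [|D DB]; last by apply: vv; rewrite inE DB orbT.
congr cat; rewrite -map_comp; apply/eq_in_map => i /kept_leq iC.
by rewrite [RHS]/= inordK ?ltnS ?(leq_trans iC) ?rk_width // vv ?mem_head.
Qed.

(** The claims need a joint induction: [lin_subst] at the root requires that the values below have
    the annotated orders and empty unkept pieces. Conversely, the value at the root is a homomorphic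
    image of the encoded component, which keeps the variables in place and empty pieces empty. *)
Lemma encode_value d B : derivation d B ->
  [/\ {in B, forall C, perm_eq (evars (lin (value d C))) (iota 0 (rk C))},
      {in B, forall C, annot d C = insub (evars (lin (value d C)))},
      {in B, forall C i, i <= rk C -> ~~ keep (rk C) i ->
         piece i (lin (value d C)) = [::]}
    & dval (encode d) = if B == [:: start G] then start_trees (value d (start G))
                        else piece_trees (value d) B].
Proof.
elim/tree_each_ind: d B => // r ds IH B /= /andP[/eqP <- dl] {B}.
set a := combine r (map annot ds); set v := link_value r ds.
pose sg := flatten (links r); pose u := flatten (map (@dval A G) ds).
have uE : u = map v sg by exact: link_values.
have uC C : C \in sg -> nth (Var 0) u (index C sg) = v C.
  by move=> Cs; rewrite uE (nth_map (start G)) ?index_mem // nth_index.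
have /(all2_nthP _ _ _ (Node r ds) [::])[sz dn] := dl.
have IHi i (il : i < size (links r)) := Each_nth (Node r ds) IH
  (eq_ind_r (leq i.+1) il sz) (nth [::] (links r) i) (dn i il).
have vspec C : C \in sg ->
    [/\ perm_eq (evars (lin (v C))) (iota 0 (rk C)),
        a C = insub (evars (lin (v C)))
      & forall i, i <= rk C -> ~~ keep (rk C) i -> piece i (lin (v C)) = [::]].
  move=> Cs; have [jl Cj] := link_index_lt Cs; have [P1 P2 P3 _] := IHi _ jl.
  split; [exact: P1| |exact: P3].
  by rewrite /a (combine_nth _ jl Cj) (nth_map (Node r ds)) ?sz // P2.
pose h := expand v.
have linC C : C \in lhs r ->
    lin (value (Node r ds) C) = hom h (enc a (component r C)).
  move=> Cr; have /andP[wt _] := component_pattern Cr.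
  rewrite /value /= (nth_map (Var 0)) ?size_rhs ?index_mem //.
  apply: lin_subst => // D /(component_links Cr) Ds.
  have [P1 P2 P3] := vspec _ Ds; rewrite uC //; split.
    by rewrite /ord P2 (insub_order P1) P1.
  move=> i iD; case: ifP => [_|/negbT k]; last exact: P3.
  by rewrite /h expand_piece.
split.
- by move=> C Cr; rewrite linC // evars_hom; apply: component_evars.
- by move=> C Cr; rewrite ffunE Cr linC // evars_hom.
- by move=> C Cr i iC k; rewrite linC // piece_hom unkept.
(* No link is the start symbol, so all values below the root are lines ending in a variable, without
   end marker. *)
have u'E : flatten (map (@dval _ string_grammar) (map encode ds)) =
    [seq line (Var 0) (h (inl q)) | q <- big_pieces a sg].
  rewrite -big_pieces_flatten map_flatten; congr flatten.
  apply: (@eq_from_nth _ [::]) => [|i]; rewrite !size_map // sz => il.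
  rewrite -map_comp (nth_map (Node r ds)) ?sz // -map_comp (nth_map [::]) //=.
  have [_ _ _ ->] := IHi i il; rewrite (negbTE (link_not_start (mem_nth _ il))).
  by apply: piece_trees_expand => C Ci; rewrite /v /link_value (link_index_nth il Ci).
rewrite -[flatten (string_links _)]/(flatten (map (big_pieces a) (links r))).
rewrite big_pieces_flatten -/sg u'E.
have substE C z i : C \in lhs r ->
    subst (big_pieces a sg) [seq line (Var 0) (h (inl q)) | q <- big_pieces a sg]
      (line z (piece i (enc a (component r C)))) =
    line (subst (big_pieces a sg)
            [seq line (Var 0) (h (inl q)) | q <- big_pieces a sg] z)
      (piece i (lin (value (Node r ds) C))).
  move=> Cr; rewrite linC // piece_hom; apply: subst_line => // q.
  rewrite mem_pmap => /mapP[[q'|//] qi [->]] {q}.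
  have /andP[wt _] := component_pattern Cr.
  have qs : inl q' \in syms (enc a (component r C)).
    exact: (mem_piece qi).
  have [D [l [DC lD qE]]] := enc_mem_nt wt qs.
  have q's : q' \in big_pieces a sg.
    by apply/big_piecesP; exists D, l; rewrite (component_links Cr DC).
  by rewrite (nth_map None) ?index_mem // nth_index.
rewrite /string_rhs /= /initial; case: ifP => [/eqP rS|_].
  by rewrite /= substE // rS inE.
have : {subset lhs r <= lhs r} by [].
rewrite /piece_trees; elim: {1 3 4}(lhs r) => //= C Cs IHs sub.
rewrite map_cat IHs => [|D Ds]; last by apply: sub; rewrite inE Ds orbT.
congr cat; rewrite -map_comp; apply: eq_map => i /=.
by rewrite substE ?sub ?mem_head.
Qed.

(** * Look-ahead and the two transducers *)

Definition agree_look (x : string_rule) i (s : tree void (rules G)) : bool :=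
  well_ranked (@rk (rules G)) s &&
  [forall (C | C \in nth [::] (links (val x).1) i), annot s C == (val x).2 C].

Lemma agree_look_regular x i : regular (agree_look x i).
Proof.
pose M := @DFTA (rules G) annotation (fun r cs => infer r (combine r cs))
  [set c : annotation |
   [forall (C | C \in nth [::] (links (val x).1) i), c C == (val x).2 C]].
exists M => t; rewrite inE /agree_look; congr (_ && _).
suff -> : annot t = dfta_run M t by [].
elim/tree_each_ind: t => //= r ts IH; congr (infer _ (combine _ _)).
by elim: ts IH => //= t ts IHts [-> /IHts ->].
Qed.

(** Two supported annotations of one rule differ at a nonterminal of some link, and a subtree has
    only one annotation, so the look-ahead on that link separates them. *)
Lemma agree_look_disjoint x x' : x != x' -> (val x).1 = (val x').1 ->
  exists2 i, i < size (links (val x).1) &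
    forall s, ~~ (agree_look x i s && agree_look x' i s).
Proof.
move=> ne Er; have [C neC] : exists C, (val x).2 C != (val x').2 C.
  apply/existsP; rewrite -negb_forall; apply: contraNN ne => /forallP Ea.
  apply/eqP/val_inj; rewrite [LHS]surjective_pairing [RHS]surjective_pairing Er.
  by congr pair; apply/ffunP => C; apply/eqP.
have Cf : C \in flatten (links (val x).1).
  apply: contraR neC => nC; have nC' := nC; rewrite Er in nC'.
  have /forallP/(_ C) := valP x; have /forallP/(_ C) := valP x'.
  by rewrite (negbTE nC) (negbTE nC') /= => /eqP -> /eqP ->.
have [il Ci] := link_index_lt Cf; exists (link_index (val x).1 C) => // s.
apply/negP => /andP[/andP[_ /forall_inP aC] /andP[_ /forall_inP aC']].
by rewrite -(eqP (aC C Ci)) (eqP (aC' C _)) ?eqxx -?Er // in neC.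
Qed.

Definition encode_ldtr : ldtr (rules G) (rules string_grammar) :=
  @relabeling (rules G) (rules string_grammar) string_rule (fun x => (val x).1) id
    agree_look (fun x => size_map _ _) (fun x i _ => agree_look_regular x i)
    agree_look_disjoint.

Lemma encode_transduces d B : derivation d B ->
  transduces (M := encode_ldtr) tt d (encode d).
Proof.
elim/tree_each_ind: d B => // r ds IH B dB.
have wd := derivation_well_ranked dB; have /= /andP[_ ] := dB.
set d0 := Node r ds; move=> /(all2_nthP _ _ _ d0 [::])[sz dn].
set x := annotated_rule r (map annot ds).
have wn i : i < size ds -> well_ranked (@rk (rules G)) (nth d0 ds i).
  by move: wd => /= /andP[_ /(all_nthP d0)]; apply.
apply: (@relabeling_node _ _ _ _ _ _ _ _ _ x _ _ d0 (encode d0)) => //.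
- by rewrite size_map.
- move=> i il; rewrite /agree_look wn //=; apply/forall_inP => C Ci.
  by rewrite (combine_nth _ _ Ci) -?sz // (nth_map d0).
- move=> i il; rewrite (nth_map d0) //.
  by apply: (Each_nth d0 IH il); apply: dn; rewrite -sz.
Qed.

(** Vacuous: each transducer rule of the decoder is indexed by its own input symbol. *)
Lemma trivial_look_disjoint (x x' : string_rule) : x != x' -> id x = id x' ->
  exists2 i, i < size (string_links x) &
    forall e, ~~ (well_ranked (@rk (rules string_grammar)) e &&
                  well_ranked (@rk (rules string_grammar)) e).
Proof. by move/eqP. Qed.

Definition decode_ldtr : ldtr (rules string_grammar) (rules G) :=
  @relabeling (rules string_grammar) (rules G) string_rule id (fun x => (val x).1)
    (fun _ _ => fun e => well_ranked (@rk _) e) (fun x => esym (size_map _ _))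
    (fun _ _ _ => @well_ranked_regular _) trivial_look_disjoint.

Lemma decode_transduces e : well_ranked (@rk (rules string_grammar)) e ->
  transduces (M := decode_ldtr) tt e (decode e).
Proof.
elim/tree_each_ind: e => // x es IH we; set e0 := Node x es.
have wn i : i < size es -> well_ranked (@rk (rules string_grammar)) (nth e0 es i).
  by move: we => /= /andP[_ /(all_nthP e0)]; apply.
apply: (@relabeling_node _ _ _ _ _ _ _ _ _ x _ _ e0 (decode e0)) => //.
- by rewrite size_map.
- move=> i il; rewrite (nth_map e0) //.
  exact: (Each_nth e0 IH il (wn i il)).
Qed.

Lemma closed_tree (t : tree nat A) : vars t = [::] ->
  exists t0 : tree void A, t = of_closed nat t0.
Proof.
elim/tree_each_ind: t => // b ts IH /= vts.
suff [ts0 ->] : exists ts0, ts = map (@of_closed nat A) ts0 by exists (Node b ts0).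
elim: ts IH vts => [|t ts IHts] /=; first by exists [::].
case=> Pt Pts /eqP; rewrite -size_eq0 size_cat addn_eq0 !size_eq0.
case/andP=> /eqP/Pt[t0 ->] /eqP/(IHts Pts)[ts0 ->].
by exists (t0 :: ts0).
Qed.

Lemma lin_of_closed (t : tree void A) :
  lin (of_closed nat t) = map inr (map Some (labels t)).
Proof.
elim/tree_each_ind: t => // b ts IH /=; congr cons.
elim: ts IH => //= t ts IHts [Pt Pts].
by rewrite !map_cat Pt IHts.
Qed.

Lemma of_closed_string_tree (t : tree void A) :
  of_closed nat (string_tree t) = line (Node None [::]) (map Some (labels t)).
Proof. by rewrite /string_tree; elim: (labels t) => //= b w <-. Qed.

Lemma encode_val_related d : Lder d -> val_related (@string_tree A) d (encode d).
Proof.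
move=> dS; have [/(_ (start G) (mem_head _ _)) P1 _ _ ev] := encode_value dS.
move: P1 ev; rewrite start_rk evars_lin eqxx => /perm_nilP/closed_tree[t vt] ev.
exists t; first by rewrite (dval_value dS) /= vt.
rewrite ev /start_trees vt lin_of_closed of_closed_string_tree.
by congr [:: line _ _]; elim: (labels t) => //= b w ->.
Qed.

Lemma string_ldtr_equivalent :
  ldtr_equivalent (@string_tree A) string_grammar G.
Proof.
have start_big a : string_big a [:: start G] = [:: None] by rewrite /string_big eqxx.
split.
  exists encode_ldtr => d dS; exists (encode d); split.
  - exact: encode_transduces dS.
  - by have := encode_derivation dS; rewrite start_big.
  - exact: encode_val_related.
exists decode_ldtr => e eS; have := eS.
rewrite /Lder -[[:: _]](start_big no_order) => /(decode_derivation (start_bignt G)).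
case=> dS ee _; exists (decode e); split => //.
  exact: decode_transduces (derivation_well_ranked eS).
(* Since [e] is the encoding of [decode e], the first direction already relates their values. *)
by rewrite -{2}ee; apply: encode_val_related.
Qed.

End Construction.

(** * Choice of the number of pieces *)

Lemma multiplicity_gt0 (A : ralphabet) (G : mcftg A) : 0 < multiplicity G.
Proof. exact: (leq_bigmax_seq (F := size) _ (start_bignt G)). Qed.

(** [c] bounds the kept pieces of one nonterminal. The emptiness hypothesis ranges over all [m]
    because the number of dummies is part of the type of encoded words. *)
Lemma string_grammar_spec (A : ralphabet) (G : mcftg A) (keep : nat -> nat -> bool)
    (keep0 : forall k, keep k 0) (c : nat) (c_gt0 : 0 < c) :
  (forall C : nt G, size (kept keep C) <= c) ->
  (forall m (a : annotation G) r (C : nt G) i, C \in lhs r -> i <= rk C ->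
     ~~ keep (rk C) i -> piece i (enc keep m a (component r C)) = [::]) ->
  exists G' : mcftg (string_alphabet A),
     [/\ is_mcfg G',
         ldtr_equivalent (@string_tree A) G' G,
         forall Delta : {set A},
           lexicalized G Delta -> lexicalized G' [set Some b | b in Delta],
         multiplicity G' = multiplicity G * c
       & rule_width G' = rule_width G].
Proof.
move=> keptc unkept; have m_gt0 : 0 < multiplicity G * c.
  by rewrite muln_gt0 multiplicity_gt0.
exists (string_grammar keep0 m_gt0 (unkept _)); split.
- exact: string_is_mcfg.
- exact: string_ldtr_equivalent.
- exact: string_lexicalized.
- apply: string_multiplicity => B a HB.
  apply: (@leq_trans (size B * c)); last first.
    by rewrite leq_mul2r (leq_bigmax_seq (F := size) _ HB) ?orbT.
  elim: B {HB} => //= C B IH; rewrite /big_pieces /= size_cat size_map mulSn.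
  exact: leq_add.
- exact: string_rule_width.
Qed.

(** * Footed grammars *)

Lemma weave_contiguous (X : Type) (p : nat -> seq (nat + X)) s i :
  (forall l, i < l < i + size s -> p l = [::]) ->
  exists y z, weave p (fun j => [:: inl j]) s i = y ++ map inl s ++ z.
Proof.
case: s => [|j s] pn; first by exists (p i), [::].
have E l w : (forall h, l <= h < l + size w -> p h = [::]) ->
    weave p (fun j => [:: inl j]) w l = map inl w ++ p (l + size w).
  elim: w l {pn} => [|j' w IH] l pn /=; first by rewrite addn0 cats0.
  rewrite pn ?leqnn ?addnS ?ltnS ?leq_addr //= IH ?addSn // => h /andP[lh hw].
  by apply: pn; rewrite (ltnW lh) addnS.
exists (p i), (p (i.+1 + size s)); rewrite /= E // => h /andP[ih hs].
by apply: pn; rewrite ih addnS.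
Qed.

(** At the foot the variables form a block: its inner separators are dropped if the label is a
    nonterminal, because it has rank [k] itself, and empty if it is a terminal. Above the foot, the
    block survives as a factor of the code of one child. *)
Lemma enc_foot (A : ralphabet) (G : mcftg A) (keep : nat -> nat -> bool) m
    (a : annotation G) k (t : tree nat (nt G + A)) :
  (forall i, 0 < i < k -> ~~ keep k i) ->
  well_ranked (@sum_rk _ _) t -> has_foot (@sum_rk _ _) k t ->
  exists y s z, enc keep m a t = y ++ map inl s ++ z /\ size s = k.
Proof.
move=> keepk; elim/tree_each_ind: t => // x ts IH wt.
have /= /andP[/eqP sz /(all_nthP (Var 0)) wts] := wt.
have nthE j : j < size ts ->
    nth [::] (map (enc keep m a) ts) j = enc keep m a (nth (Var 0) ts j).
  by move=> js; rewrite (nth_map (Var 0)).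
case/orP=> [/andP[/eqP xk /eqP foot]|/(has_nthP (Var 0))[j js jfoot]].
  have tsE : ts = map Var (iota 0 k).
    elim: ts (iota 0 k) foot {sz wts wt IH nthE} => [|t ts IHts] [|j s] //=.
    by case: t => // j' [-> /IHts ->].
  rewrite (@eq_weave _ _ (sym_piece keep m a x) _ (fun j => [:: inl j]))
    => [|//|j]; last first.
    rewrite mem_sym_order xk => jk; rewrite nthE; last by rewrite sz xk.
    by rewrite tsE (nth_map 0) ?size_iota // nth_iota.
  have [l /andP[l0 lk]|y [z ->]] :=
      @weave_contiguous _ (sym_piece keep m a x) (sym_order a x) 0.
    rewrite size_sym_order xk add0n in lk.
    case: x xk {wt foot sz} => [C|b] /= xk; last by case: l l0 {lk}.
    by rewrite xk (negbTE (keepk l _)) // l0.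
  by exists y, (sym_order a x), z; rewrite size_sym_order.
have [y [s [z [E sk]]]] := Each_nth (Var 0) IH js (wts j js) jfoot.
have jx : j \in sym_order a x by rewrite mem_sym_order -sz.
have [y' [z' ->]] := weave_mem (sym_piece keep m a x)
  (nth [::] (map (enc keep m a) ts)) 0 jx.
by exists (y' ++ y), s, (z ++ z'); rewrite nthE // E -!catA.
Qed.

Definition ends k i : bool := (i == 0) || (i == k).

(** Only a bound, since at rank 0 the two ends coincide. *)
Lemma size_ends (A : ralphabet) (G : mcftg A) (C : nt G) : size (kept ends C) <= 2.
Proof.
have -> : 2 = size [:: 0; rk C] by [].
apply: uniq_leq_size; first by rewrite filter_uniq ?iota_uniq.
by move=> i; rewrite mem_filter !inE => /andP[].
Qed.

Lemma footed_unkept (A : ralphabet) (G : mcftg A) (ftG : footed G) m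
    (a : annotation G) r (C : nt G) i : C \in lhs r -> i <= rk C ->
  ~~ ends (rk C) i -> piece i (enc ends m a (component r C)) = [::].
Proof.
move=> Cr iC; rewrite negb_or -lt0n => /andP[i0 ik].
have ltiC : i < rk C by rewrite ltn_neqAle ik.
have /all2_nthP - /(_ (start G) (Var 0))[_] := ftG r.
rewrite size_rhs => /(_ (index C (lhs r))); rewrite index_mem nth_index //.
move=> /(_ Cr); rewrite -/(component r C) /footed_pattern.
rewrite -[rk C == 0]negbK -lt0n (leq_trans i0) //= => foot.
have /andP[wt _] := component_pattern Cr.
have [l /andP[l0 lk]|y [s [z [E sk]]]] := enc_foot (keep := ends) m a _ wt foot.
  by rewrite /ends negb_or -lt0n l0 neq_ltn lk.
(* The word has [rk C] variables and the block already contains that many, so the parts around it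
   contain none and every inner piece is empty. *)
have := component_size_evars ends m a Cr; rewrite E !evars_cat evars_inl !size_cat sk.
rewrite addnCA -[X in _ = X]addn0 => /eqP.
rewrite eqn_add2l addn_eq0 !size_eq0 => /andP[/eqP/evars_nil -> /eqP/evars_nil ->].
by apply: piece_inner; rewrite sk i0.
Qed.

Theorem theorem67 (Sigma : ralphabet) (G : mcftg Sigma) :
  (exists G' : mcftg (string_alphabet Sigma),
     [/\ is_mcfg G',
         ldtr_equivalent (@string_tree Sigma) G' G,
         forall Delta : {set Sigma},
           lexicalized G Delta -> lexicalized G' [set Some a | a in Delta],
         multiplicity G' = multiplicity G * (width G).+1
       & rule_width G' = rule_width G])
  /\
  (footed G ->
   exists G' : mcftg (string_alphabet Sigma),
     [/\ is_mcfg G',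
         ldtr_equivalent (@string_tree Sigma) G' G,
         forall Delta : {set Sigma},
           lexicalized G Delta -> lexicalized G' [set Some a | a in Delta],
         multiplicity G' = 2 * multiplicity G
       & rule_width G' = rule_width G]).
Proof.
split=> [|ftG].
  (* With every piece kept the emptiness condition is vacuous, and rank k gives k+1 pieces, at most
     [(width G).+1]. *)
  apply: (@string_grammar_spec _ G (fun _ _ => true)) => // C.
  by rewrite /kept filter_predT size_iota ltnS rk_width.
rewrite mulnC; apply: (@string_grammar_spec _ G ends) => //.
  exact: size_ends.
exact: footed_unkept.
Qed.
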